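(* Suppose Assumptions 1, 2 and 3 hold. Then \[ \frac{1}{\sqrt{dr}}\big\|U^{(\lambda)}_{\mathsf{deb}}U^{(\lambda)\top}_{\mathsf{deb}}-U^{(0)}U^{(0)\top}\big\|_F=O\Big(\sigma r\sqrt{\tfrac{d}{n}}\Big) \] with probability at least $1-O\big(\exp(-c\,dr)+\exp(-cn)+\exp(-cd)\big)$.
   Context: Setting. Let $d,n,r$ be positive integers and $\sigma>0$. $\mathsf{GOE}(d)$ denotes the law of a symmetric $d\times d$ matrix whose diagonal entries are i.i.d. $N(0,1)$ and whose entries above the diagonal are i.i.d. $N(0,1/2)$, independent of the diagonal. One observes $(y_i,X_i)$, $i=1,\dots,n$, with $y_i=n^{-1/2}\langle X_i,M\rangle+\varepsilon_i$, where $\langle\cdot,\cdot\rangle$ is the Frobenius inner product, $X_i\sim\mathsf{GOE}(d)$, $\varepsilon_i\sim N(0,\sigma^2)$, all mutually independent, and $M$ is a symmetric positive semidefinite matrix of rank $r$. For $U\in\mathbb{R}^{d\times r}$ let $f^{(\lambda)}(U)=\frac14\sum_{i=1}^n(y_i-n^{-1/2}\langle X_i,UU^\top\rangle)^2+\frac{\lambda}{2}\|U\|_F^2$; $U^{(\lambda)}$ denotes any point satisfying the first- and second-order necessary conditions for a local minimum of $f^{(\lambda)}$ (with $\lambda=0$ giving $U^{(0)}$). Debiased factor: $U^{(\lambda)}_{\mathsf{deb}}=U^{(\lambda)}\big(I+\lambda(U^{(\lambda)\top}U^{(\lambda)})^{-1}\big)^{1/2}$. Assumption 1: $M=\sqrt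 d\,V\Lambda V^\top$ with $V\in\mathbb{R}^{d\times r}$ having orthonormal columns and $\Lambda$ an $r\times r$ positive diagonal matrix whose smallest entry $\lambda_r$ satisfies $C_1\sqrt r<\lambda_r/\sigma<C_2\sqrt r$ for sufficiently large constants $C_1,C_2$; moreover $\|M\|/(\lambda_r\sqrt d)\le\kappa$ with $\kappa=O(1)$, and $\sigma\ge\sigma_{\min}>c>0$. Assumption 2: $\gamma_n:=n/(dr)$ satisfies $\gamma_n\ge C_3 r$ for a sufficiently large constant $C_3$. Assumption 3: $C_4\sqrt d\le\lambda/\sigma\le C_5\sqrt d$ for constants $C_4,C_5$. *)

(* Defs.v *)
From HB Require Import structures.
From mathcomp Require Import all_boot all_order all_algebra.
From mathcomp Require Import all_classical all_reals all_analysis.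
Set Implicit Arguments. Unset Strict Implicit. Unset Printing Implicit Defensive.
Import Order.TTheory GRing.Theory Num.Theory.
Local Open Scope classical_set_scope.
Local Open Scope ring_scope.

Section defs.
Context {R : realType}.

Definition frob_inner {m k : nat} (A B : 'M[R]_(m, k)) : R :=
  \sum_(i < m) \sum_(j < k) A i j * B i j.
Definition frob_norm {m k : nat} (A : 'M[R]_(m, k)) : R :=
  Num.sqrt (frob_inner A A).

Definition vec_norm {m : nat} (v : 'cV[R]_m) : R :=
  Num.sqrt (\sum_(i < m) v i 0 ^+ 2).
Definition op_norm {m k : nat} (A : 'M[R]_(m, k)) : R :=
  sup [set vec_norm (A *m v) | v in [set v : 'cV[R]_k | vec_norm v = 1]].

Definition min_entry {k : nat} (lam : 'I_k -> R) : R := inf (range lam).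

Definition psd {k : nat} (S : 'M[R]_k) : Prop :=
  forall v : 'cV[R]_k, 0 <= (v^T *m S *m v) 0 0.
Definition psd_sqrt {k : nat} (A : 'M[R]_k) : 'M[R]_k :=
  xget 0 [set S : 'M[R]_k | S^T = S /\ psd S /\ S *m S = A].

Definition signal {d r : nat} (V : 'M[R]_(d, r)) (lam : 'rV[R]_r) : 'M[R]_d :=
  Num.sqrt d%:R *: (V *m diag_mx lam *m V^T).

Definition lr_loss {d n r : nat} (y : 'I_n -> R) (X : 'I_n -> 'M[R]_d) (lambda : R)
  (U : 'M[R]_(d, r)) : R :=
  4^-1 * \sum_(i < n) (y i - (Num.sqrt n%:R)^-1 * frob_inner (X i) (U *m U^T)) ^+ 2
  + lambda / 2 * frob_norm U ^+ 2.

Definition second_order_critical {m k : nat} (f : 'M[R]_(m, k) -> R) (U : 'M[R]_(m, k)) : Prop :=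
  forall H : 'M[R]_(m, k),
    derive1 (fun t : R => f (U + t *: H)) 0 = 0 /\
    0 <= derive1n 2 (fun t : R => f (U + t *: H)) 0.

Definition debias {d r : nat} (lambda : R) (U : 'M[R]_(d, r)) : 'M[R]_(d, r) :=
  U *m psd_sqrt (1%:M + lambda *: invmx (U^T *m U)).

Definition mutually_independent {dT} {T : measurableType dT} (P : probability T R)
  {I : finType} (Z : I -> T -> R) : Prop :=
  forall B : I -> set R, (forall i, measurable (B i)) ->
    P (\bigcap_i (Z i @^-1` B i)) = (\prod_(i : I) P (Z i @^-1` B i))%E.

(* A real random variable with law N(m, s^2) (s = standard deviation) *)
Definition has_normal_law {dT} {T : measurableType dT} (P : probability T R)
  (m s : R) (Z : T -> R) : Prop :=
  measurable_fun setT Z /\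
  forall B : set R, measurable B -> P (Z @^-1` B) = normal_prob m s B.

End defs.

Definition goe_index (n d : nat) := {x : 'I_n * 'I_d * 'I_d | (x.1.2 <= x.2)%N}.

Definition goe_model {R : realType} {dT} {T : measurableType dT} (P : probability T R)
  (n d : nat) (sigma : R) (Xs : 'I_n -> 'I_d -> 'I_d -> T -> R) (eps : 'I_n -> T -> R) : Prop :=
  (forall i j k w, Xs i j k w = Xs i k j w) /\
  (forall i j, has_normal_law P 0 1 (Xs i j j)) /\
  (forall i (j k : 'I_d), (j < k)%N -> has_normal_law P 0 (Num.sqrt 2^-1) (Xs i j k)) /\
  (forall i, has_normal_law P 0 sigma (eps i)) /\
  mutually_independent P
    (fun z : goe_index n d + 'I_n =>
       match z with
       | inl x => Xs (val x).1.1 (val x).1.2 (val x).2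
       | inr i => eps i
       end).

Definition goe_mat {R : realType} {T} {n d : nat} (Xs : 'I_n -> 'I_d -> 'I_d -> T -> R)
  (w : T) (i : 'I_n) : 'M[R]_d := \matrix_(j, k) Xs i j k w.

Definition response {R : realType} {T} {n d : nat} (M : 'M[R]_d)
  (Xs : 'I_n -> 'I_d -> 'I_d -> T -> R) (eps : 'I_n -> T -> R) (w : T) (i : 'I_n) : R :=
  (Num.sqrt n%:R)^-1 * frob_inner (goe_mat Xs w i) M + eps i w.

(* Main.v *)
Require Import Defs.
From HB Require Import structures.
From mathcomp Require Import all_boot all_order all_algebra.
From mathcomp Require Import all_classical all_reals all_analysis.
From mathcomp Require Import measurable_realfun ring lra.
Set Implicit Arguments. Unset Strict Implicit. Unset Printing Implicit Defensive.
Import Order.TTheory GRing.Theory Num.Theory.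
Import numFieldNormedType.Exports.
Local Open Scope classical_set_scope.
Local Open Scope ring_scope.

(* Write S(U) = M + N + Delta(M - U U^T), where N is the noise matrix
   n^(-1/2) sum_i eps_i X_i and Delta(B) = n^(-1) sum_i <X_i, B> X_i - B.  The first-order
   condition reads S(U) U = U (U^T U + lambda), so the columns of U span an invariant
   subspace of S(U), and U_deb U_deb^T = U (1 + lambda (U^T U)^(-1)) U^T is exactly the
   compression P S(U) P = P S(U) to that subspace.  The second-order condition together
   with a dimension count against the range of M forces the subspace to be the one of
   the top r eigenvalues, which are separated from the rest of the spectrum.  Hence
   debiased estimators for different lambda are top-r parts of the matrices S(U^(lambda))
   and S(U^(0)), which differ only by Delta(U0 U0^T - Ul Ul^T), and a sin-theta argument
   bounds their distance.
   It is enough to control Delta on rank-one matrices,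
   |y^T Delta(x x^T) y| <= eta |x|^2 |y|^2 with eta = O(sqrt(d / n)): by the spectral theorem
   |Delta(B)| <= eta rank(B) |B| in operator norm, and Assumption 2 makes eta r small.
   By polarization this bound, and the bound |N| = O(sigma sqrt d), reduce to deviations of
   sums of squares of Gaussian linear forms at the points of a net of the unit ball. *)

(** * Inner product and operator norm *)

Section dot_product.
Context {R : realType}.

(** The matrix S(U) depends on the unknown point U, so its distance to M cannot be bounded outright.
    The first-order condition supplies an a priori bound of order |M| on U U^T; smallness of eta r
    turns it into |S(U) - M| <= m/10 with m = lambda_r sqrt(d). Only then do the spectral facts
    apply, and they sharpen |M - U U^T| to O(nu + |lambda|), where nu bounds |N|. Controlling Delta
    on rank-one matrices keeps the net at 2^O(d) points, where a net of rank-r matrices would have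
    2^O(dr); the price is the factor r in eta r, which is why n must exceed a multiple of d r^2. The
    bounds are uniform in x and y, so one event serves all critical points at once. The rate is
    sqrt(r) from operator to Frobenius norm, times r eta from Delta, times sigma sqrt(d) from |M - U
    U^T|; division by sqrt(d r) leaves sigma r sqrt(d/n). *)

Definition dot {m : nat} (x y : 'cV[R]_m) : R := (x^T *m y) 0 0.

Lemma dotE m (x y : 'cV[R]_m) : dot x y = \sum_i x i 0 * y i 0.
Proof. by rewrite /dot mxE; apply: eq_bigr => i _; rewrite mxE. Qed.

Lemma dotC m (x y : 'cV[R]_m) : dot x y = dot y x.
Proof. by rewrite !dotE; apply: eq_bigr => i _; rewrite mulrC. Qed.

Lemma dotDl m (x y z : 'cV[R]_m) : dot (x + y) z = dot x z + dot y z.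
Proof. by rewrite /dot linearD mulmxDl mxE. Qed.

Lemma dotDr m (x y z : 'cV[R]_m) : dot z (x + y) = dot z x + dot z y.
Proof. by rewrite /dot mulmxDr mxE. Qed.

Lemma dotNl m (x y : 'cV[R]_m) : dot (- x) y = - dot x y.
Proof. by rewrite /dot linearN mulNmx mxE. Qed.

Lemma dotNr m (x y : 'cV[R]_m) : dot x (- y) = - dot x y.
Proof. by rewrite /dot mulmxN mxE. Qed.

Lemma dotZl m a (x y : 'cV[R]_m) : dot (a *: x) y = a * dot x y.
Proof. by rewrite /dot linearZ -scalemxAl mxE. Qed.

Lemma dotZr m a (x y : 'cV[R]_m) : dot x (a *: y) = a * dot x y.
Proof. by rewrite /dot -scalemxAr mxE. Qed.

Lemma dot0l m (x : 'cV[R]_m) : dot 0 x = 0.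
Proof. by rewrite /dot trmx0 mul0mx mxE. Qed.

Lemma dot0r m (x : 'cV[R]_m) : dot x 0 = 0.
Proof. by rewrite dotC dot0l. Qed.

Lemma dot_mulr m k (A : 'M[R]_(m, k)) x y : dot x (A *m y) = dot (A^T *m x) y.
Proof. by rewrite /dot trmx_mul trmxK mulmxA. Qed.

Lemma dot_mull m k (A : 'M[R]_(m, k)) x y : dot (A *m x) y = dot x (A^T *m y).
Proof. by rewrite dot_mulr trmxK. Qed.

Definition dot_linE := (dotDl, dotDr, dotNl, dotNr, dotZl, dotZr, dot0l, dot0r).

Lemma dot_ge0 m (x : 'cV[R]_m) : 0 <= dot x x.
Proof. by rewrite dotE sumr_ge0// => i _; rewrite -expr2 sqr_ge0. Qed.

Lemma dot_eq0 m (x : 'cV[R]_m) : (dot x x == 0) = (x == 0).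
Proof.
apply/eqP/eqP => [|->]; last by rewrite dot0l.
rewrite dotE => /eqP; rewrite psumr_eq0; last first.
  by move=> i _; rewrite -expr2 sqr_ge0.
move=> /allP x0; apply/matrixP => i j; rewrite (ord1 j) mxE.
have := x0 i; rewrite mem_index_enum => /(_ isT)/=.
by rewrite mulf_eq0 orbb => /eqP.
Qed.

Lemma dot_gt0 m (x : 'cV[R]_m) : (0 < dot x x) = (x != 0).
Proof. by rewrite lt0r dot_eq0 dot_ge0 andbT. Qed.

Lemma dot_CS m (x y : 'cV[R]_m) : dot x y ^+ 2 <= dot x x * dot y y.
Proof.
have [->|y0] := eqVneq y 0; first by rewrite !dot0r expr0n mulr0.
have yp : 0 < dot y y by rewrite dot_gt0.
have := dot_ge0 (dot y y *: x - dot x y *: y).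
rewrite !dot_linE (dotC y x) => h.
have : 0 <= dot y y * (dot x x * dot y y - dot x y ^+ 2) by lra.
by rewrite pmulr_rge0// subr_ge0.
Qed.

Lemma vec_normE m (x : 'cV[R]_m) : vec_norm x = Num.sqrt (dot x x).
Proof. by rewrite /vec_norm dotE. Qed.

Lemma vec_norm_ge0 m (x : 'cV[R]_m) : 0 <= vec_norm x.
Proof. by rewrite vec_normE sqrtr_ge0. Qed.

Lemma sqr_vec_norm m (x : 'cV[R]_m) : vec_norm x ^+ 2 = dot x x.
Proof. by rewrite vec_normE sqr_sqrtr ?dot_ge0. Qed.

Lemma vec_norm_eq0 m (x : 'cV[R]_m) : (vec_norm x == 0) = (x == 0).
Proof. by rewrite -dot_eq0 -sqr_vec_norm sqrf_eq0. Qed.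

Lemma vec_normZ m a (x : 'cV[R]_m) : vec_norm (a *: x) = `|a| * vec_norm x.
Proof.
rewrite !vec_normE !dot_linE mulrA -expr2 sqrtrM ?sqr_ge0//.
by rewrite sqrtr_sqr.
Qed.

Lemma vec_norm_le m (x : 'cV[R]_m) c :
  0 <= c -> (vec_norm x <= c) = (dot x x <= c ^+ 2).
Proof.
move=> c0; rewrite -sqr_vec_norm.
by rewrite -[RHS]ler_sqrt ?sqr_ge0// !sqrtr_sqr !ger0_norm ?vec_norm_ge0.
Qed.

Lemma dot_le m (x y : 'cV[R]_m) : `|dot x y| <= vec_norm x * vec_norm y.
Proof.
rewrite -ler_sqr ?nnegrE ?mulr_ge0 ?vec_norm_ge0//.
by rewrite exprMn !sqr_vec_norm real_normK ?num_real// dot_CS.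
Qed.

Lemma vec_normD m (x y : 'cV[R]_m) : vec_norm (x + y) <= vec_norm x + vec_norm y.
Proof.
rewrite vec_norm_le ?addr_ge0 ?vec_norm_ge0// sqrrD !sqr_vec_norm !dot_linE.
rewrite (dotC y x); have := ler_norm (dot x y); have := dot_le x y.
by move=> h1 h2; lra.
Qed.

Lemma vec_norm_unit m (x : 'cV[R]_m) : vec_norm x = 1 <-> dot x x = 1.
Proof.
split=> [h|h]; first by rewrite -sqr_vec_norm h expr1n.
by rewrite vec_normE h sqrtr1.
Qed.

End dot_product.

Section operator_norm.
Context {R : realType}.

Lemma sum_sqr_dot m k (A : 'M[R]_(m, k)) (x : 'cV[R]_k) :
  dot (A *m x) (A *m x) <= frob_norm A ^+ 2 * dot x x.
Proof.
rewrite /frob_norm sqr_sqrtr; last first.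
  by apply: sumr_ge0 => i _; apply: sumr_ge0 => j _; rewrite -expr2 sqr_ge0.
rewrite dotE /frob_inner mulr_suml ler_sum// => i _.
pose a : 'cV[R]_k := (row i A)^T.
have -> : (A *m x) i 0 = dot a x.
  by rewrite dotE mxE; apply: eq_bigr => j _; rewrite !mxE.
have -> : \sum_j A i j * A i j = dot a a.
  by rewrite dotE; apply: eq_bigr => j _; rewrite !mxE.
by rewrite -expr2 dot_CS.
Qed.

Lemma vec_norm_mul_frob m k (A : 'M[R]_(m, k)) (x : 'cV[R]_k) :
  vec_norm (A *m x) <= frob_norm A * vec_norm x.
Proof.
rewrite vec_norm_le ?mulr_ge0 ?vec_norm_ge0 ?sqrtr_ge0//.
by rewrite exprMn sqr_vec_norm sum_sqr_dot.
Qed.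

Lemma op_norm_ub m k (A : 'M[R]_(m, k)) v :
  vec_norm v = 1 -> vec_norm (A *m v) <= op_norm A.
Proof.
move=> v1; apply: ub_le_sup; last by exists v.
exists (frob_norm A) => _ [x /= x1 <-].
by rewrite (le_trans (vec_norm_mul_frob A x))// x1 mulr1.
Qed.

Lemma op_norm_le m k (A : 'M[R]_(m, k)) c : 0 <= c ->
  (forall v, vec_norm v = 1 -> vec_norm (A *m v) <= c) -> op_norm A <= c.
Proof.
move=> c0 h; rewrite /op_norm.
set B := [set _ | _ in _].
have [->|/set0P B0] := eqVneq B set0; first by rewrite sup0.
by apply: ge_sup => // _ [x /= x1 <-]; exact: h.
Qed.

Lemma op_norm_ge0 m k (A : 'M[R]_(m, k)) : 0 <= op_norm A.
Proof.
rewrite /op_norm; set B := [set _ | _ in _].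
have [->|/set0P[_ [x /= x1 _]]] := eqVneq B set0; first by rewrite sup0.
by rewrite (le_trans (vec_norm_ge0 (A *m x)))// op_norm_ub.
Qed.

Lemma op_normP m k (A : 'M[R]_(m, k)) x :
  vec_norm (A *m x) <= op_norm A * vec_norm x.
Proof.
have [->|x0] := eqVneq x 0.
  by rewrite mulmx0 !vec_normE !dot0l sqrtr0 mulr0.
have nx : 0 < vec_norm x by rewrite lt0r vec_norm_eq0 x0 vec_norm_ge0.
have : vec_norm ((vec_norm x)^-1 *: x) = 1.
  by rewrite vec_normZ ger0_norm ?invr_ge0 ?ltW// mulVf ?gt_eqF.
move/(op_norm_ub A); rewrite -scalemxAr vec_normZ ger0_norm ?invr_ge0 ?vec_norm_ge0//.
by rewrite ler_pdivrMl// mulrC.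
Qed.

Lemma op_norm_dot m k (A : 'M[R]_(m, k)) x y :
  `|dot y (A *m x)| <= op_norm A * (vec_norm y * vec_norm x).
Proof.
apply: (le_trans (dot_le _ _)); rewrite mulrCA ler_wpM2l ?vec_norm_ge0//.
exact: op_normP.
Qed.

Lemma op_norm_quad m (A : 'M[R]_m) x : `|dot x (A *m x)| <= op_norm A * dot x x.
Proof. by rewrite -sqr_vec_norm expr2 op_norm_dot. Qed.

Lemma op_normD m k (A B : 'M[R]_(m, k)) : op_norm (A + B) <= op_norm A + op_norm B.
Proof.
apply: op_norm_le => [|v v1]; first by rewrite addr_ge0 ?op_norm_ge0.
by rewrite mulmxDl (le_trans (vec_normD _ _))// lerD// op_norm_ub.
Qed.

Lemma op_normN m k (A : 'M[R]_(m, k)) : op_norm (- A) = op_norm A.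
Proof.
congr sup; apply/seteqP; split=> _ [v v1 <-]; exists v => //.
  by rewrite mulNmx !vec_normE dotNl dotNr opprK.
by rewrite mulNmx !vec_normE dotNl dotNr opprK.
Qed.

Lemma op_normB m k (A B : 'M[R]_(m, k)) : op_norm (A - B) <= op_norm A + op_norm B.
Proof. by rewrite -(op_normN B) op_normD. Qed.

Lemma op_normM m k l (A : 'M[R]_(m, k)) (B : 'M[R]_(k, l)) :
  op_norm (A *m B) <= op_norm A * op_norm B.
Proof.
apply: op_norm_le => [|v v1]; first by rewrite mulr_ge0 ?op_norm_ge0.
rewrite -mulmxA (le_trans (op_normP _ _))// ler_wpM2l ?op_norm_ge0//.
exact: op_norm_ub.
Qed.

Lemma op_norm_tr_le m k (A : 'M[R]_(m, k)) : op_norm A^T <= op_norm A.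
Proof.
apply: op_norm_le => [|v v1]; first exact: op_norm_ge0.
have [h0|h0] := eqVneq (vec_norm (A^T *m v)) 0; first by rewrite h0 op_norm_ge0.
have hp : 0 < vec_norm (A^T *m v) by rewrite lt0r h0 vec_norm_ge0.
rewrite -(ler_pM2r hp) -expr2 sqr_vec_norm dot_mull trmxK.
by rewrite (le_trans (ler_norm _))// (le_trans (op_norm_dot _ _ _))// v1 mul1r.
Qed.

Lemma op_norm_tr m k (A : 'M[R]_(m, k)) : op_norm A^T = op_norm A.
Proof.
by apply/eqP; rewrite eq_le op_norm_tr_le -{1}(trmxK A) op_norm_tr_le.
Qed.

(** For u the direction of A v, |A v| = u.A v is a quarter of the difference of the quadratic forms
    at u + v and u - v; the parallelogram law bounds it by c. *)
Lemma op_norm_sym_le m (A : 'M[R]_m) c : 0 <= c -> A^T = A ->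
  (forall x, `|dot x (A *m x)| <= c * dot x x) -> op_norm A <= c.
Proof.
move=> c0 sA h; apply: op_norm_le => // v v1.
have [h0|h0] := eqVneq (vec_norm (A *m v)) 0; first by rewrite h0.
have hp : 0 < vec_norm (A *m v) by rewrite lt0r h0 vec_norm_ge0.
pose u := (vec_norm (A *m v))^-1 *: (A *m v).
have u1 : dot u u = 1.
  by rewrite /u dotZl dotZr -sqr_vec_norm expr2 mulKf// mulVf.
have vv : dot v v = 1 by apply/vec_norm_unit.
have -> : vec_norm (A *m v) = dot u (A *m v).
  by rewrite /u dotZl -sqr_vec_norm expr2 mulKf.
clearbody u.
have uv : dot v (A *m u) = dot u (A *m v) by rewrite dot_mulr sA dotC.
have := h (u + v); have := h (u - v).
rewrite !mulmxDr !mulmxN !dot_linE uv u1 vv (dotC v u).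
rewrite !ler_norml => /andP[h1 _] /andP[_ h2]; lra.
Qed.

Lemma op_norm_scalar m (a : R) : op_norm (a%:M : 'M[R]_m) <= `|a|.
Proof.
by apply: op_norm_le => // v v1; rewrite mul_scalar_mx vec_normZ v1 mulr1.
Qed.

Lemma op_norm_proj m (P : 'M[R]_m) : P^T = P -> P *m P = P -> op_norm P <= 1.
Proof.
move=> sP PP; apply: op_norm_sym_le => // x.
have e1 : dot x (P *m x) = dot (P *m x) (P *m x) by rewrite dot_mull sP mulmxA PP.
have := dot_ge0 (x - P *m x).
rewrite !dot_linE (dotC _ x) e1 ger0_norm ?dot_ge0// => h; lra.
Qed.

Lemma op_norm_sqr_sym m (A : 'M[R]_m) : A^T = A ->
  op_norm A ^+ 2 <= op_norm (A *m A).
Proof.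
move=> sA; rewrite -[leRHS]sqr_sqrtr ?op_norm_ge0// ler_sqr ?nnegrE ?op_norm_ge0 ?sqrtr_ge0//.
apply: op_norm_le => [|v v1]; first exact: sqrtr_ge0.
rewrite vec_norm_le ?sqrtr_ge0// sqr_sqrtr ?op_norm_ge0// dot_mull sA mulmxA.
rewrite (le_trans (ler_norm _))// (le_trans (op_norm_quad _ _))//.
by rewrite (vec_norm_unit v).1// mulr1.
Qed.

End operator_norm.

(** * Spectral theorem for real symmetric matrices *)

Section spectral.
Context {R : realType}.

(** Points are row vectors, the type on which [EVT_max_rV] provides a maximum over a compact set. *)
Lemma continuous_quad d (A : 'M[R]_d) :
  continuous (fun x : 'rV[R]_d => dot x^T (A *m x^T)).
Proof.
have -> : (fun x : 'rV[R]_d => dot x^T (A *m x^T)) =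
    (fun x => \sum_i \sum_j x 0 i * (A i j * x 0 j)).
  apply/funext => x; rewrite dotE; apply: eq_bigr => i _.
  rewrite !mxE mulr_sumr; apply: eq_bigr => j _.
  by rewrite !mxE.
have add2 : continuous (fun z : R * R => z.1 + z.2).
  by move=> z; apply: cvgD; [exact: cvg_fst|exact: cvg_snd].
have sumc (F : 'I_d -> 'rV[R]_d -> R) : (forall i, continuous (F i)) ->
    continuous (fun x => \sum_i F i x).
  by move=> cF; apply: (@continuous_big R _ _ 0 xpredT add2).
apply: (sumc _) => i; apply: (sumc _) => j.
have cc l : continuous (fun x : 'rV[R]_d => x 0 l) by exact: coord_continuous.
move=> x; apply: (@continuousM _ _ (fun x : 'rV[R]_d => x 0 i)
  (fun x : 'rV[R]_d => A i j * x 0 j)); first exact: cc.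
by apply: (@continuousM _ _ (fun=> A i j) (fun x : 'rV[R]_d => x 0 j));
  [exact: cst_continuous|exact: cc].
Qed.

Lemma compact_sphere d : compact [set x : 'rV[R]_d | dot x^T x^T = 1].
Proof.
apply: bounded_closed_compact.
  exists 1; split; first exact: num_real.
  move=> M M1 x /= x1; rewrite [leLHS]/Num.norm/= mx_normrE.
  apply: bigmax_le => [|[i j] _]; first by rewrite (le_trans _ (ltW M1)).
  rewrite (le_trans _ (ltW M1))//= -(@expr_le1 _ 2)//=.
rewrite real_normK ?num_real//.
  rewrite (ord1 i) -x1 dotE (bigD1 j)//= !mxE -expr2 lerDl.
  by apply: sumr_ge0 => k _; rewrite !mxE -expr2 sqr_ge0.
have -> : [set x : 'rV[R]_d | dot x^T x^T = 1] =
    (fun x : 'rV[R]_d => dot x^T (1%:M *m x^T)) @^-1` [set y | y = 1].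
  by apply/seteqP; split => x /=; rewrite mul1mx.
apply: preimage_closed; last exact: closed_eq.
by move=> x _; exact: continuous_quad.
Qed.

(** Moving from v along -t B v changes the form by -2 t |B v|^2 + O(t^2), which would be negative
    for small t > 0 unless B v = 0. *)
Lemma psd_quad_eq0 d (B : 'M[R]_d) v : B^T = B ->
  (forall x, 0 <= dot x (B *m x)) -> dot v (B *m v) = 0 -> B *m v = 0.
Proof.
move=> sB h v0; apply/eqP; rewrite -dot_eq0; set a := dot _ _.
have [//|a0] := eqVneq a 0.
have ap : 0 < a by rewrite lt0r a0 dot_ge0.
set b := dot (B *m v) (B *m (B *m v)).
have E t : 0 <= - 2 * t * a + t ^+ 2 * b.
  have := h (v - t *: (B *m v)).
  rewrite !mulmxDr !mulmxN -!scalemxAr !dot_linE v0 (dot_mulr B v) sB.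
  by rewrite -/a -/b; lra.
have b0 : 0 <= b by apply: h.
(* Any small t works; this one is defined also when b = 0. *)
have := E (a / (b + 1)); have b1 : b + 1 != 0 by rewrite gt_eqF// ltr_wpDl.
have -> : - 2 * (a / (b + 1)) * a + (a / (b + 1)) ^+ 2 * b =
  - ((a / (b + 1)) ^+ 2 * (b + 2)) by field.
rewrite oppr_ge0 leNgt => /negP[].
by rewrite mulr_gt0 ?exprn_gt0 ?divr_gt0//; lra.
Qed.

(** The vector maximizes x.A x on the unit sphere, with maximum mu: then mu - A is positive
    semidefinite and its form vanishes at v, hence (mu - A) v = 0. Positivity at [x0] makes mu >
    0. *)
Lemma eigenvector_pos d (A : 'M[R]_d) x0 : A^T = A -> 0 < dot x0 (A *m x0) ->
  exists v mu, [/\ dot v v = 1, 0 < mu & A *m v = mu *: v].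
Proof.
move=> sA q0.
have x00 : x0 != 0.
  by apply: contraTneq q0 => ->; rewrite mulmx0 dot0l ltxx.
have n0 : 0 < vec_norm x0 by rewrite lt0r vec_norm_eq0 x00 vec_norm_ge0.
pose u := (vec_norm x0)^-1 *: x0.
have u1 : dot u u = 1.
  by rewrite /u dotZl dotZr -sqr_vec_norm expr2 mulKf ?mulVf// gt_eqF.
have S0 : [set x : 'rV[R]_d | dot x^T x^T = 1] !=set0.
  by exists u^T; rewrite /= trmxK.
have cw : {within [set x : 'rV[R]_d | dot x^T x^T = 1],
    continuous (fun x : 'rV[R]_d => dot x^T (A *m x^T))}.
  by apply: continuous_subspaceT; exact: continuous_quad.
have [c cS cmax] := EVT_max_rV S0 (@compact_sphere d) cw.
rewrite inE/= in cS.
pose v := c^T; pose mu := dot v (A *m v).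
have unitle x : dot x x = 1 -> dot x (A *m x) <= mu.
  move=> x1; have := cmax x^T; rewrite trmxK; apply.
  by rewrite inE/= trmxK.
have le x : dot x (A *m x) <= mu * dot x x.
  have [->|xn0] := eqVneq x 0; first by rewrite mulmx0 !dot0l mulr0.
  have nx : 0 < vec_norm x by rewrite lt0r vec_norm_eq0 xn0 vec_norm_ge0.
  have := unitle ((vec_norm x)^-1 *: x).
  rewrite -!scalemxAr !dot_linE -!sqr_vec_norm expr2 mulKf ?gt_eqF//.
  rewrite mulVf ?gt_eqF// => /(_ erefl).
  by rewrite ler_pdivrMl// ler_pdivrMl// => h; lra.
have vv : dot v v = 1 by [].
have mup : 0 < mu.
  by have := le x0; have := dot_ge0 x0; move=> h1 h2; nra.
exists v, mu; split => //.
apply/eqP; rewrite eq_sym -subr_eq0 -mul_scalar_mx -mulmxBl; apply/eqP.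
apply: psd_quad_eq0.
- by rewrite linearB /= tr_scalar_mx sA.
- by move=> x; rewrite mulmxBl mul_scalar_mx !dot_linE subr_ge0.
- by rewrite mulmxBl mul_scalar_mx !dot_linE vv mulr1 subrr.
Qed.

Lemma quad_eq0 d (A : 'M[R]_d) : A^T = A ->
  (forall x, dot x (A *m x) = 0) -> A = 0.
Proof.
move=> sA h; apply/matrixP => i j; rewrite mxE.
have := h (delta_mx i 0 + delta_mx j 0).
rewrite !mulmxDr !dot_linE !h (dot_mulr A (delta_mx j 0)) sA.
have -> : dot (delta_mx i 0) (A *m delta_mx j 0) = A i j.
  rewrite dotE (bigD1 i)//= big1 ?addr0 => [|k ki].
    rewrite !mxE eqxx mul1r (bigD1 j)//= big1 ?addr0 ?mxE ?eqxx ?mulr1 // => k kj.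
    by rewrite !mxE (negPf kj) mulr0.
  by rewrite !mxE (negPf ki) mul0r.
have -> : dot (A *m delta_mx j 0) (delta_mx i 0) = A i j.
  rewrite dotC dotE (bigD1 i)//= big1 ?addr0 => [|k ki].
    rewrite !mxE eqxx mul1r (bigD1 j)//= big1 ?addr0 ?mxE ?eqxx ?mulr1 // => k kj.
    by rewrite !mxE (negPf kj) mulr0.
  by rewrite !mxE (negPf ki) mul0r.
lra.
Qed.

Lemma eigenvector_neq0 d (A : 'M[R]_d) : A^T = A -> A != 0 ->
  exists v mu, [/\ dot v v = 1, mu != 0 & A *m v = mu *: v].
Proof.
move=> sA A0.
have [x0 qx] : exists x, dot x (A *m x) != 0.
  apply: contrapT => h; case/negP: A0; apply/eqP/quad_eq0 => // x.
  by apply/eqP/negPn/negP => hx; apply: h; exists x.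
have [q0|q0] := ltP 0 (dot x0 (A *m x0)).
  have [v [mu [v1 mu0 Av]]] := eigenvector_pos sA q0.
  by exists v, mu; rewrite gt_eqF.
have qn : 0 < dot x0 (- A *m x0).
  by rewrite mulNmx dotNr oppr_gt0 lt_neqAle qx.
have [|v [mu [v1 mu0 Av]]] := eigenvector_pos _ qn.
  by rewrite linearN /= sA.
exists v, (- mu); rewrite oppr_eq0 gt_eqF//; split => //.
by rewrite scaleNr -Av mulNmx opprK.
Qed.

Lemma mulmx_scalar11 m (x y : 'cV[R]_m) : x^T *m y = (dot x y)%:M.
Proof. by rewrite [LHS]mx11_scalar. Qed.

(** Deflation: subtracting mu v v^T for a nonzero eigenvalue lowers the rank by exactly one. Keeping
    only nonzero eigenvalues makes the number of terms equal to the rank, the source of the later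
    factors rank and sqrt(rank). *)
Theorem spectral_rank d (A : 'M[R]_d) k : A^T = A -> \rank A = k ->
  exists (W : 'M[R]_(d, k)) (mu : 'rV[R]_k),
    [/\ W^T *m W = 1%:M, forall j, mu 0 j != 0 & A = W *m diag_mx mu *m W^T].
Proof.
elim: k A => [|k IH] A sA rA.
  have /eqP -> : A == 0 by rewrite -mxrank_eq0 rA.
  exists 0, 0; split; first by apply/matrixP => -[].
    by move=> [].
  by rewrite !mul0mx.
have [|v [mu [v1 mu0 Av]]] := eigenvector_neq0 sA.
  by rewrite -mxrank_eq0 rA.
pose B := A - mu *: (v *m v^T).
have sB : B^T = B.
  by rewrite /B linearB /= sA linearZ /= trmx_mul trmxK.
have Bv : B *m v = 0.
  rewrite /B mulmxBl Av -scalemxAl -mulmxA mulmx_scalar11 v1 mulmx1.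
  by rewrite subrr.
have vA : (v^T <= A)%MS.
  apply/submxP; exists (mu^-1 *: v^T).
  rewrite -scalemxAl -{1}sA -trmx_mul Av linearZ /= scalerA mulVf// scale1r //.
have BA : (B <= A)%MS.
  rewrite /B addmx_sub ?submx_refl// -scaleNr scalemx_sub//.
  by rewrite mulmx_sub.
(* The row space strictly shrinks: v^T lies in that of A, but B annihilates v while v.v = 1. *)
have vB : ~~ (v^T <= B)%MS.
  apply/negP => /submxP[D vD].
  have : v^T *m v = 0 by rewrite vD -mulmxA Bv mulmx0.
  rewrite mulmx_scalar11 v1 => /matrixP /(_ 0 0); rewrite !mxE => /eqP.
  by rewrite eqxx oner_eq0.
have rB : \rank B = k.
  have h1 : (\rank B < \rank A)%N.
    suff : (B < A)%MS by rewrite ltmxErank => /andP[].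
    by rewrite /ltmx BA; apply: contra vB; exact: submx_trans.
  have h2 : (\rank A <= \rank B + 1)%N.
    have -> : A = B + mu *: (v *m v^T) by rewrite subrK.
    rewrite (leq_trans (mxrank_add _ _))// leq_add2l.
    rewrite (leq_trans (mxrank_scale _ _))//.
    by rewrite (leq_trans (mxrankM_maxl _ _))// rank_leq_col.
  by move: h1 h2; rewrite rA addn1 !ltnS => h1 h2; apply/eqP; rewrite eqn_leq h1.
have [W [nu [WW nu0 BW]]] := IH B sB rB.
have Wv : W^T *m v = 0.
  have h : diag_mx nu *m (W^T *m v) = 0.
    have := congr1 (mulmx W^T) Bv; rewrite mulmx0 {1}BW.
    by rewrite !mulmxA WW mul1mx -!mulmxA.
  apply/matrixP => i j; move/matrixP: h => /(_ i j).
  rewrite mul_diag_mx !mxE => /eqP; rewrite mulf_eq0 (negPf (nu0 i)) /=.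
  by move/eqP.
have vW : v^T *m W = 0.
  by rewrite -[LHS]trmxK trmx_mul trmxK Wv trmx0.
change (exists (W : 'M[R]_(d, 1 + k)%N) (mu : 'rV[R]_(1 + k)%N),
  [/\ W^T *m W = 1%:M, forall j, mu 0 j != 0 & A = W *m diag_mx mu *m W^T]).
exists (row_mx v W), (row_mx (mu%:M : 'M[R]_1) nu); split.
- rewrite tr_row_mx mul_col_row vW Wv WW mulmx_scalar11 v1.
  by rewrite -scalar_mx_block.
- move=> j; rewrite mxE; case: splitP => i _; last exact: nu0.
  by rewrite (ord1 i) mxE eqxx.
- rewrite tr_row_mx diag_mx_row mul_row_block !mulmx0 addr0 add0r.
  rewrite mul_row_col -BW.
  suff -> : diag_mx (mu%:M : 'M[R]_1) = mu%:M.
    by rewrite mul_mx_scalar -scalemxAl addrC subrK.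
  by apply/matrixP => i j; rewrite !mxE (ord1 i) (ord1 j) eqxx.
Qed.

End spectral.

(** * First- and second-order conditions *)

Section frobenius.
Context {R : realType}.

Lemma frob_innerE m k (A B : 'M[R]_(m, k)) : frob_inner A B = \tr (A^T *m B).
Proof.
rewrite /frob_inner exchange_big /=; apply: eq_bigr => j _.
by rewrite mxE; apply: eq_bigr => i _; rewrite !mxE.
Qed.

Lemma frob_innerC m k (A B : 'M[R]_(m, k)) : frob_inner A B = frob_inner B A.
Proof. by rewrite !frob_innerE -mxtrace_tr trmx_mul trmxK. Qed.

Lemma frob_innerDr m k (A B C : 'M[R]_(m, k)) :
  frob_inner A (B + C) = frob_inner A B + frob_inner A C.
Proof. by rewrite !frob_innerE mulmxDr linearD. Qed.

Lemma frob_innerZr m k a (A B : 'M[R]_(m, k)) :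
  frob_inner A (a *: B) = a * frob_inner A B.
Proof. by rewrite !frob_innerE -scalemxAr linearZ. Qed.

Lemma frob_innerNr m k (A B : 'M[R]_(m, k)) : frob_inner A (- B) = - frob_inner A B.
Proof. by rewrite !frob_innerE mulmxN linearN. Qed.

Lemma frob_innerNl m k (A B : 'M[R]_(m, k)) : frob_inner (- B) A = - frob_inner B A.
Proof. by rewrite frob_innerC frob_innerNr (frob_innerC A). Qed.

Lemma frob_innerDl m k (A B C : 'M[R]_(m, k)) :
  frob_inner (B + C) A = frob_inner B A + frob_inner C A.
Proof. by rewrite frob_innerC frob_innerDr !(frob_innerC A). Qed.

Lemma frob_innerZl m k a (A B : 'M[R]_(m, k)) :
  frob_inner (a *: B) A = a * frob_inner B A.
Proof. by rewrite frob_innerC frob_innerZr (frob_innerC A). Qed.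

Lemma frob_inner_sumr m k I (r : seq I) (A : 'M[R]_(m, k)) F :
  frob_inner A (\sum_(i <- r) F i) = \sum_(i <- r) frob_inner A (F i).
Proof.
by rewrite frob_innerE mulmx_sumr linear_sum; apply: eq_bigr => i _;
  rewrite frob_innerE.
Qed.

Lemma frob_inner_suml m k I (r : seq I) (A : 'M[R]_(m, k)) F :
  frob_inner (\sum_(i <- r) F i) A = \sum_(i <- r) frob_inner (F i) A.
Proof.
by rewrite frob_innerC frob_inner_sumr; under eq_bigr do rewrite frob_innerC.
Qed.

Lemma frob_inner_ge0 m k (A : 'M[R]_(m, k)) : 0 <= frob_inner A A.
Proof. by apply: sumr_ge0 => i _; apply: sumr_ge0 => j _; rewrite -expr2 sqr_ge0. Qed.

Lemma frob_inner_eq0 m k (A : 'M[R]_(m, k)) : frob_inner A A = 0 -> A = 0.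
Proof.
move=> /eqP; rewrite psumr_eq0 => [/allP h|i _]; last first.
  by apply: sumr_ge0 => j _; rewrite -expr2 sqr_ge0.
apply/matrixP => i j; rewrite mxE.
have /= := h i (mem_index_enum i); rewrite psumr_eq0 => [/allP g|l _]; last first.
  by rewrite -expr2 sqr_ge0.
by have /= := g j (mem_index_enum j); rewrite mulf_eq0 orbb => /eqP.
Qed.

Lemma sqr_frob_norm m k (A : 'M[R]_(m, k)) : frob_norm A ^+ 2 = frob_inner A A.
Proof. by rewrite sqr_sqrtr ?frob_inner_ge0. Qed.

Lemma frob_inner_mulr m k l (A : 'M[R]_(m, k)) (B : 'M[R]_(m, l)) (C : 'M[R]_(l, k)) :
  frob_inner A (B *m C) = frob_inner (A *m C^T) B.
Proof. by rewrite !frob_innerE trmx_mul trmxK mulmxA mxtrace_mulC mulmxA. Qed.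

Lemma frob_inner_tr m k (A B : 'M[R]_(m, k)) :
  frob_inner A^T B^T = frob_inner A B.
Proof. by rewrite /frob_inner exchange_big; do 2![apply: eq_bigr => ? _]; rewrite !mxE. Qed.

Lemma frob_inner_col m (x y : 'cV[R]_m) : frob_inner x y = dot x y.
Proof. by rewrite frob_innerE /mxtrace big_ord1 /dot. Qed.

Lemma frob_inner_outer m k (A : 'M[R]_(m, k)) x y :
  frob_inner A (x *m y^T) = dot x (A *m y).
Proof. by rewrite frob_inner_mulr trmxK frob_innerC frob_inner_col. Qed.

End frobenius.

Section criticality.
Context {R : realType} {d n r : nat}.
Variables (y : 'I_n -> R) (X : 'I_n -> 'M[R]_d) (lambda : R).
Hypothesis symX : forall i, (X i)^T = X i.

Let c : R := (Num.sqrt n%:R)^-1.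

Definition residual (U : 'M[R]_(d, r)) i := y i - c * frob_inner (X i) (U *m U^T).

Definition residual_mx (U : 'M[R]_(d, r)) : 'M[R]_d :=
  \sum_i (c * residual U i) *: X i.

Let p (U H : 'M[R]_(d, r)) i := c * frob_inner (X i) (U *m H^T + H *m U^T).
Let s (H : 'M[R]_(d, r)) i := c * frob_inner (X i) (H *m H^T).

Let c1 U H := lambda * frob_inner U H - 2^-1 * \sum_i residual U i * p U H i.
Let c2 U H := 4^-1 * \sum_i (p U H i ^+ 2 - 2 * residual U i * s H i) +
  lambda / 2 * frob_inner H H.

(** The loss is quadratic in U U^T, hence quartic in t along a line. Written as a polynomial
    evaluation, its derivatives at 0 are read off the coefficients: [c1] for the first, twice [c2]
    for the second. *)
Let loss_line U H : (fun t : R => lr_loss y X lambda (U + t *: H)) =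
  horner ((lr_loss y X lambda U)%:P + c1 U H *: 'X + c2 U H *: 'X^2
   + (2^-1 * \sum_i p U H i * s H i) *: 'X^3 + (4^-1 * \sum_i s H i ^+ 2) *: 'X^4).
Proof.
apply/funext => t; rewrite !(hornerD, hornerZ, hornerC, hornerX, hornerXn) /lr_loss !sqr_frob_norm -/c.
rewrite !frob_innerDl !frob_innerDr !frob_innerZl !frob_innerZr (frob_innerC H U).
have E i : y i - c * frob_inner (X i) ((U + t *: H) *m (U + t *: H)^T) =
    residual U i - t * p U H i - t ^+ 2 * s H i.
  have -> : (U + t *: H)^T = U^T + t *: H^T by rewrite linearD linearZ.
  rewrite /residual /p /s mulmxDl !mulmxDr -!scalemxAr -!scalemxAl.
  by rewrite !frob_innerDr !frob_innerZr; ring.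
under eq_bigr do rewrite E.
have -> : \sum_i (residual U i - t * p U H i - t ^+ 2 * s H i) ^+ 2 =
  \sum_i residual U i ^+ 2 - 2 * t * \sum_i residual U i * p U H i +
  t ^+ 2 * \sum_i (p U H i ^+ 2 - 2 * residual U i * s H i) +
  2 * t ^+ 3 * \sum_i p U H i * s H i + t ^+ 4 * \sum_i s H i ^+ 2.
  rewrite !mulr_sumr -sumrB -!big_split /=; apply: eq_bigr => i _; ring.
have -> : \sum_(i < n) (y i - c * frob_inner (X i) (U *m U^T)) ^+ 2 =
  \sum_i residual U i ^+ 2 by [].
by rewrite /c1 /c2; field.
Qed.

Lemma critical_line (U H : 'M[R]_(d, r)) :
  second_order_critical (lr_loss y X lambda) U -> c1 U H = 0 /\ 0 <= 2 * c2 U H.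
Proof.
have D (q : {poly R}) : derive1 (horner q : R -> R) = horner q^`() := esym (derivE q).
move=> /(_ H); rewrite /derive1n loss_line /= !D.
rewrite !(derivD, derivC, derivZ, derivX, derivXn, derivMn).
rewrite !(hornerD, hornerMn, hornerZ, hornerC, hornerX, hornerXn) /=.
rewrite !(expr0n, mul0rn, mulr0, addr0, add0r, expr0, mulr1) /=.
by rewrite [2 * _]mulrC.
Qed.

(** [c1 U H] is minus the inner product of H with the difference of the two sides; taking H to be
    that difference makes its norm vanish. *)
Lemma critical_residual (U : 'M[R]_(d, r)) :
  second_order_critical (lr_loss y X lambda) U -> residual_mx U *m U = lambda *: U.
Proof.
move=> cU; apply/eqP; rewrite -subr_eq0; apply/eqP/frob_inner_eq0.
set H := _ - _; have [+ _] := critical_line H cU; rewrite /c1.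
have -> : \sum_i residual U i * p U H i = 2 * frob_inner (residual_mx U *m U) H.
  rewrite frob_innerC frob_inner_mulr frob_innerC /residual_mx frob_inner_suml mulr_sumr.
  apply: eq_bigr => i _; rewrite frob_innerZl /p frob_innerDr.
  have -> : frob_inner (X i) (U *m H^T) = frob_inner (X i) (H *m U^T).
    by rewrite -frob_inner_tr symX trmx_mul trmxK.
  ring.
rewrite mulrA mulVf ?pnatr_eq0// mul1r => h.
by rewrite {1}/H frob_innerDl frob_innerNl frob_innerZl -[LHS]opprB h oppr0.
Qed.

(** The test direction is H = x v^T with v a unit vector: H H^T = x x^T brings in the residual form
    at x, and U H^T + H U^T brings in 2 x.X_i U v. *)
Lemma critical_curvature (U : 'M[R]_(d, r)) (x : 'cV[R]_d) (v : 'cV[R]_r) :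
  second_order_critical (lr_loss y X lambda) U -> U^T *m x = 0 -> dot v v = 1 ->
  dot x (residual_mx U *m x) <=
    2 * (n%:R^-1 * \sum_i dot x (X i *m (U *m v)) ^+ 2) + lambda * dot x x.
Proof.
move=> cU Ux v1; have [_ +] := critical_line (x *m v^T) cU.
have HH : frob_inner (x *m v^T) (x *m v^T) = dot x x.
  by rewrite frob_inner_outer -mulmxA mulmx_scalar11 v1 mulmx1.
have xx : (x *m v^T) *m (x *m v^T)^T = x *m x^T.
  by rewrite trmx_mul trmxK mulmxA -(mulmxA x) mulmx_scalar11 v1 mulmx1.
have sE i : s (x *m v^T) i = c * dot x (X i *m x).
  by rewrite /s xx frob_inner_outer.
have pE i : p U (x *m v^T) i = 2 * c * dot x (X i *m (U *m v)).
  have e1 : U *m (x *m v^T)^T = U *m v *m x^T by rewrite trmx_mul trmxK mulmxA.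
  have e2 : x *m v^T *m U^T = x *m (U *m v)^T by rewrite trmx_mul mulmxA.
  rewrite /p frob_innerDr e1 e2.
  have -> : frob_inner (X i) (U *m v *m x^T) = dot x (X i *m (U *m v)).
    by rewrite frob_inner_outer dot_mulr symX dotC.
  rewrite frob_inner_outer; ring.
have cc : c ^+ 2 = n%:R^-1 by rewrite exprVn sqr_sqrtr.
rewrite /c2 HH; under eq_bigr do rewrite pE sE.
rewrite -frob_inner_outer /residual_mx frob_inner_suml.
under [in X in _ -> X]eq_bigr do rewrite frob_innerZl frob_inner_outer.
have -> : \sum_i ((2 * c * dot x (X i *m (U *m v))) ^+ 2 -
    2 * residual U i * (c * dot x (X i *m x))) =
  4 * n%:R^-1 * \sum_i dot x (X i *m (U *m v)) ^+ 2 -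
  2 * \sum_i c * residual U i * dot x (X i *m x).
  rewrite !mulr_sumr -sumrB; apply: eq_bigr => i _; rewrite -cc; ring.
lra.
Qed.

End criticality.

(** * Rank and the empirical Gram operator *)

Section spectral_bounds.
Context {R : realType}.

Lemma kernel_vector m k (A : 'M[R]_(m, k)) : (\rank A < k)%N ->
  exists2 a : 'cV[R]_k, a != 0 & A *m a = 0.
Proof.
move=> rA; pose K := kermx A^T.
have K0 : K != 0.
  by rewrite kermx_eq0 /row_free mxrank_tr neq_ltn rA.
exists (nz_row K)^T; first by rewrite trmx_eq0 nz_row_eq0.
have := nz_row_sub K; rewrite sub_kermx => /eqP h.
by rewrite -[A]trmxK -trmx_mul h trmx0.
Qed.

Lemma dot_col k m (W : 'M[R]_(m, k)) i j : W^T *m W = 1%:M ->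
  dot (col i W) (col j W) = (i == j)%:R.
Proof.
move=> /matrixP /(_ i j); rewrite !mxE => <-; rewrite dotE.
by apply: eq_bigr => l _; rewrite !mxE.
Qed.

Lemma spectral_col k m (W : 'M[R]_(m, k)) (mu : 'rV[R]_k) j : W^T *m W = 1%:M ->
  W *m diag_mx mu *m W^T *m col j W = mu 0 j *: col j W.
Proof.
move=> WW; have -> : col j W = W *m delta_mx j 0 by rewrite colE.
rewrite -!mulmxA (mulmxA W^T) WW mul1mx scalemxAr; congr (W *m _).
by apply/matrixP => a b; rewrite mul_diag_mx !mxE; case: eqP => [->|]; rewrite //= !mulr0.
Qed.

Lemma spectral_sum k m (W : 'M[R]_(m, k)) (mu : 'rV[R]_k) :
  W *m diag_mx mu *m W^T = \sum_j mu 0 j *: (col j W *m (col j W)^T).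
Proof.
apply/matrixP => a b; rewrite mul_mx_diag summxE !mxE.
by apply: eq_bigr => j _; rewrite !mxE big_ord1 !mxE mulrAC mulrC mulrA.
Qed.

Lemma spectral_le k m (W : 'M[R]_(m, k)) (mu : 'rV[R]_k) j : W^T *m W = 1%:M ->
  `|mu 0 j| <= op_norm (W *m diag_mx mu *m W^T).
Proof.
move=> WW; have := op_norm_quad (W *m diag_mx mu *m W^T) (col j W).
by rewrite spectral_col// !dot_linE dot_col// eqxx !mulr1.
Qed.

(** The squared Frobenius norm is a sum of at most k squared eigenvalues. *)
Lemma frob_norm_rank m (B : 'M[R]_m) k : B^T = B -> (\rank B <= k)%N ->
  frob_norm B <= Num.sqrt k%:R * op_norm B.
Proof.
move=> sB; move rBE : (\rank B) => l lk.
have [W [mu [WW _ BE]]] := spectral_rank sB rBE.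
have -> : op_norm B = Num.sqrt (op_norm B ^+ 2) by rewrite sqrtr_sqr ger0_norm ?op_norm_ge0.
rewrite -sqrtrM ?ler0n// ler_sqrt ?mulr_ge0 ?ler0n ?op_norm_ge0//.
rewrite {2}BE spectral_sum frob_inner_sumr.
have E j : frob_inner B (mu 0 j *: (col j W *m (col j W)^T)) = mu 0 j ^+ 2.
  rewrite frob_innerZr frob_inner_outer {1}BE spectral_col// !dot_linE.
  by rewrite dot_col// eqxx mulr1 expr2.
under eq_bigr do rewrite E.
apply: (@le_trans _ _ (\sum_(j < l) op_norm B ^+ 2)).
  apply: ler_sum => j _; rewrite -real_normK ?num_real//.
  by rewrite ler_sqr ?nnegrE ?op_norm_ge0// BE spectral_le.
rewrite sumr_const card_ord -[leLHS]mulr_natl ler_wpM2r ?sqr_ge0//.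
by rewrite ler_nat.
Qed.

End spectral_bounds.

Section gram_error.
Context {R : realType} {d n : nat}.
Variables (X : 'I_n -> 'M[R]_d) (eta : R).
Hypothesis symX : forall i, (X i)^T = X i.

(** The GOE variances (1 on the diagonal, 1/2 off it) are such that <X, B> X has mean B for
    symmetric B, so subtracting B below centres the empirical average. *)
Definition gram (B : 'M[R]_d) : 'M[R]_d :=
  n%:R^-1 *: \sum_i frob_inner (X i) B *: X i.
Definition gram_err (B : 'M[R]_d) : 'M[R]_d := gram B - B.

Hypothesis eta0 : 0 <= eta.
Hypothesis rank1 : forall x y,
  `|dot y (gram_err (x *m x^T) *m y)| <= eta * (dot x x * dot y y).

Lemma gramD A B : gram (A + B) = gram A + gram B.
Proof.
rewrite /gram -scalerDr -big_split /=; congr (_ *: _).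
by apply: eq_bigr => i _; rewrite frob_innerDr scalerDl.
Qed.

Lemma gramZ a B : gram (a *: B) = a *: gram B.
Proof.
rewrite /gram scalerA mulrC -scalerA scaler_sumr; congr (_ *: _).
by apply: eq_bigr => i _; rewrite frob_innerZr scalerA.
Qed.

Lemma gram_errD A B : gram_err (A + B) = gram_err A + gram_err B.
Proof. by rewrite /gram_err gramD opprD addrACA. Qed.

Lemma gram_errZ a B : gram_err (a *: B) = a *: gram_err B.
Proof. by rewrite /gram_err gramZ scalerBr. Qed.

Lemma gram_errN B : gram_err (- B) = - gram_err B.
Proof. by rewrite -scaleN1r gram_errZ scaleN1r. Qed.

Lemma gram_err_sum I (s : seq I) F :
  gram_err (\sum_(i <- s) F i) = \sum_(i <- s) gram_err (F i).
Proof.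
elim: s => [|i s IH]; last by rewrite !big_cons gram_errD IH.
by rewrite !big_nil -(scale0r 0) gram_errZ !scale0r.
Qed.

Lemma gram_err_sym B : B^T = B -> (gram_err B)^T = gram_err B.
Proof.
move=> sB; rewrite /gram_err /gram linearB /= sB linearZ /= linear_sum /=.
by under eq_bigr do rewrite linearZ /= symX.
Qed.

Lemma dot_sumr k I (s : seq I) (x : 'cV[R]_k) F :
  dot x (\sum_(i <- s) F i) = \sum_(i <- s) dot x (F i).
Proof. by rewrite /dot mulmx_sumr summxE. Qed.

Lemma gram_err_op (B : 'M[R]_d) k : B^T = B -> (\rank B <= k)%N ->
  op_norm (gram_err B) <= eta * k%:R * op_norm B.
Proof.
move=> sB; move rBE : (\rank B) => l lk.
have [W [mu [WW _ BE]]] := spectral_rank sB rBE.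
apply: op_norm_sym_le; first by rewrite !mulr_ge0 ?op_norm_ge0.
  exact: gram_err_sym.
move=> x; rewrite {1}BE spectral_sum gram_err_sum mulmx_suml dot_sumr.
apply: (le_trans (ler_norm_sum _ _ _)).
apply: (@le_trans _ _ (\sum_(j < l) eta * op_norm B * dot x x)).
  apply: ler_sum => j _; rewrite gram_errZ -scalemxAl dotZr normrM.
  have := rank1 (col j W) x; rewrite dot_col// eqxx mul1r => h.
  rewrite (mulrC eta) -mulrA ler_pM//.
  by rewrite BE spectral_le.
rewrite sumr_const card_ord -[leLHS]mulr_natl !mulrA ler_wpM2r ?dot_ge0//.
rewrite ler_wpM2r ?op_norm_ge0// mulrC ler_wpM2l//.
by rewrite ler_nat.
Qed.

(** The left side is symmetric in a and b, so the rank-one matrix and the test vector can exchange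
    roles in the net argument. *)
Lemma gram_rank1 a b :
  n%:R^-1 * \sum_i dot a (X i *m a) * dot b (X i *m b) =
  dot b (gram_err (a *m a^T) *m b) + dot a b ^+ 2.
Proof.
rewrite /gram_err /gram mulmxBl !dot_linE -scalemxAl dotZr mulmx_suml dot_sumr.
have -> : dot b (a *m a^T *m b) = dot a b ^+ 2.
  by rewrite -mulmxA mulmx_scalar11 mul_mx_scalar dotZr (dotC b) expr2.
rewrite subrK; congr (_ * _); apply: eq_bigr => i _.
by rewrite frob_inner_outer -scalemxAl dotZr.
Qed.

(** When |x| = |p|, the vectors a = x + p and b = x - p are orthogonal and x.X p = (a.X a - b.X
    b)/4, so the square expands into three rank-one Gram values. The main part 1/2 is the GOE
    variance of x.X p for orthonormal x and p. *)
Lemma gram_cross x p : dot x p = 0 ->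
  n%:R^-1 * \sum_i dot x (X i *m p) ^+ 2 <= (2^-1 + eta) * (dot x x * dot p p).
Proof.
have [->|x0] := eqVneq x 0.
  rewrite big1 ?mulr0 => [|i _]; last by rewrite dot0l expr0n.
  by rewrite !dot0l !(mul0r, mulr0).
have [->|p0] := eqVneq p 0.
  rewrite big1 ?mulr0 => [|i _]; last by rewrite mulmx0 dot0r expr0n.
  by rewrite !dot0l !(mul0r, mulr0).
(* Both sides are homogeneous of degree 2 in x and in p, so the lengths may be equalized. *)
wlog e : x p x0 p0 / dot x x = dot p p => [wl|] xp.
  have nx : 0 < vec_norm x by rewrite lt0r vec_norm_eq0 x0 vec_norm_ge0.
  have np : 0 < vec_norm p by rewrite lt0r vec_norm_eq0 p0 vec_norm_ge0.
  have := wl (vec_norm p *: x) (vec_norm x *: p).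
  rewrite !scaler_eq0 !negb_or !gt_eqF// x0 p0 => /(_ isT isT).
  rewrite !dot_linE xp !mulr0 -!sqr_vec_norm => /(_ _ erefl).
  set a := vec_norm x in nx *; set b := vec_norm p in np *.
  have -> : b * (b * a ^+ 2) = a * (a * b ^+ 2) by ring.
  move=> /(_ erefl).
  have -> : \sum_i dot (b *: x) (X i *m (a *: p)) ^+ 2 =
     (a ^+ 2 * b ^+ 2) * \sum_i dot x (X i *m p) ^+ 2.
    rewrite mulr_sumr; apply: eq_bigr => i _.
    by rewrite -scalemxAr !dot_linE; ring.
  move=> h; rewrite -(@ler_pM2l _ (a ^+ 2 * b ^+ 2)); last by rewrite mulr_gt0 ?exprn_gt0.
  by move: h; congr (_ <= _); ring.
pose a := x + p; pose b := x - p.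
have aa : dot a a = 2 * dot x x by rewrite /a !dot_linE -e (dotC p x) xp; ring.
have bb : dot b b = 2 * dot x x by rewrite /b !dot_linE -e (dotC p x) xp; ring.
have ab : dot a b = 0 by rewrite /a /b !dot_linE -e (dotC p x) xp; ring.
have -> : n%:R^-1 * \sum_i dot x (X i *m p) ^+ 2 =
  16^-1 * (n%:R^-1 * \sum_i dot a (X i *m a) * dot a (X i *m a)
     - 2 * (n%:R^-1 * \sum_i dot a (X i *m a) * dot b (X i *m b))
     + n%:R^-1 * \sum_i dot b (X i *m b) * dot b (X i *m b)).
  rewrite !mulr_sumr -sumrB -big_split /= mulr_sumr; apply: eq_bigr => i _.
  have xpX : dot p (X i *m x) = dot x (X i *m p) by rewrite dot_mulr symX dotC.
  by rewrite /a /b !mulmxDr !mulmxN !dot_linE xpX; move: (n%:R^-1) => ?; field.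
rewrite !gram_rank1 aa bb ab -e.
have h1 := rank1 a a; have h2 := rank1 b b; have h3 := rank1 a b.
rewrite aa ?bb in h1 h2 h3.
move: h1 h2 h3; rewrite !ler_norml => /andP[_ h1] /andP[_ h2] /andP[h3 _].
lra.
Qed.

End gram_error.

(** * One critical point *)

Section one_point.
Context {R : realType} {d r : nat}.
Variables (S M : 'M[R]_d) (V U : 'M[R]_(d, r)) (m lambda e : R).
Hypothesis m0 : 0 < m.
Hypothesis symS : S^T = S.
Hypothesis VV : V^T *m V = 1%:M.
Hypothesis symM : M^T = M.
Hypothesis psdM : forall x : 'cV[R]_d, 0 <= dot x (M *m x).
Hypothesis M_lower : forall a : 'cV[R]_r, m * dot a a <= dot (V *m a) (M *m (V *m a)).
Hypothesis M_perp : forall x : 'cV[R]_d, V^T *m x = 0 -> M *m x = 0.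
Hypothesis SM : op_norm (S - M) <= e.
Hypothesis em : e <= m / 10.
Hypothesis lam_m : `|lambda| <= m / 20.
Hypothesis foc : S *m U = U *m (U^T *m U) + lambda *: U.
Hypothesis soc : forall (x : 'cV[R]_d) (v : 'cV[R]_r), U^T *m x = 0 -> dot v v = 1 ->
  dot x (S *m x) <= (lambda + 11 / 10 * dot (U *m v) (U *m v)) * dot x x.

Let lam_lo : - (m / 20) <= lambda.
Proof. by move: lam_m; rewrite ler_norml => /andP[]. Qed.
Let lam_hi : lambda <= m / 20.
Proof. by move: lam_m; rewrite ler_norml => /andP[]. Qed.

Let S_M x : `|dot x (S *m x) - dot x (M *m x)| <= e * dot x x.
Proof.
have := op_norm_quad (S - M) x; rewrite mulmxBl !dot_linE => /le_trans; apply.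
by rewrite ler_wpM2r ?dot_ge0.
Qed.

Let e0 : 0 <= e.
Proof. exact: le_trans (op_norm_ge0 _) SM. Qed.

Let VVdot a : dot (V *m a) (V *m a) = dot a a.
Proof. by rewrite dot_mulr mulmxA VV mul1mx. Qed.

Local Ltac hyps := have := m0; have := em; have := lam_hi; have := lam_lo; have := e0;
  move=> ? ? ? ? ?.
Local Ltac slra := hyps; lra.
Local Ltac snra := hyps; nra.

(* If [U^T U v = t v] with small [t], then some [x] in the signal space is a
   combination of [U v] and of a vector orthogonal to the columns of [U]; there
   the curvature bound contradicts the size of [M]. *)
Lemma eigen_factor_ge v t : dot v v = 1 -> U^T *m U *m v = t *: v -> 3 / 4 * m <= t.
Proof.
move=> v1 Gv.
(* Since v^T N = 0, N is rank deficient; a null vector a of N gives a signal vector x = V a with U^T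
   x parallel to v. *)
pose N := (1%:M - v *m v^T) *m U^T *m V.
have vN : v^T *m N = 0.
  rewrite /N !mulmxA mulmxBr mulmx1 mulmxA mulmx_scalar11 v1 mul1mx subrr.
  by rewrite !mul0mx.
have rN : (\rank N < r)%N.
  rewrite ltn_neqAle rank_leq_row andbT.
  apply/negP => /(@mulmx_free_eq0 _ _ _ _ v^T N); rewrite vN eqxx trmx_eq0.
  by move=> /esym /eqP v0; move: v1; rewrite v0 dot0l => /eqP; rewrite eq_sym oner_eq0.
have [a a0 Na] := kernel_vector rN.
pose x := V *m a; pose c := dot v (U^T *m x).
have Ux : U^T *m x = c *: v.
  apply/eqP; rewrite -subr_eq0; apply/eqP; rewrite -Na /N /x -!mulmxA mulmxBl mul1mx.
  by rewrite -[in RHS]mulmxA mulmx_scalar11 mul_mx_scalar.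
have tE : dot (U *m v) (U *m v) = t.
  by rewrite dot_mulr mulmxA Gv dotZl v1 mulr1.
have t0 : 0 <= t by rewrite -tE dot_ge0.
(* If t = 0 then U v = 0, so c = 0 and the value 0 is consistent with b t = c. *)
pose b := if t == 0 then 0 else c / t.
have bt : b * t = c.
  rewrite /b; case: eqP => [t00|/eqP tn0]; last by rewrite divfK.
  have : U *m v = 0 by apply/eqP; rewrite -dot_eq0 tE t00.
  by rewrite mul0r /c dot_mulr trmxK => ->; rewrite dot0l.
pose x0 := x - b *: (U *m v).
have Ux0 : U^T *m x0 = 0.
  by rewrite /x0 mulmxBr Ux -scalemxAr mulmxA Gv scalerA bt subrr.
have xE : x = x0 + b *: (U *m v) by rewrite subrK.
clearbody x0 b.
have x0Uv : dot x0 (U *m v) = 0 by rewrite dot_mulr Ux0 dot0l.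
have SUv : S *m (U *m v) = (t + lambda) *: (U *m v).
  rewrite mulmxA foc mulmxDl -mulmxA Gv -scalemxAl -scalemxAr -scalerDl //.
have xx : dot x x = dot x0 x0 + b ^+ 2 * t.
  by rewrite xE !dot_linE tE (dotC (U *m v)) x0Uv; ring.
have xSx : dot x (S *m x) = dot x0 (S *m x0) + b ^+ 2 * (t + lambda) * t.
  rewrite xE mulmxDr -scalemxAr SUv !dot_linE tE x0Uv.
  rewrite (dot_mulr S (U *m v) x0) symS SUv !dot_linE (dotC (U *m v)) x0Uv; ring.
have h1 := soc Ux0 v1; rewrite tE in h1.
have h2 := S_M x; have h3 := M_lower a.
have ap : 0 < dot a a by rewrite dot_gt0.
have xa : dot x x = dot a a := VVdot a.
have h4 : (m - e) * dot x x <= dot x (S *m x).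
  by move: h2; rewrite ler_norml => /andP[h2 _]; rewrite -/x -xa in h3; slra.
have h5 : dot x (S *m x) <= (lambda + 11 / 10 * t) * dot x x.
  have h6 : 0 <= b ^+ 2 * t * t by rewrite mulr_ge0 ?(mulr_ge0 _ t0) ?sqr_ge0.
  rewrite xSx xx; slra.
(* With e <= m/10 and |lambda| <= m/20 this gives t >= (17/20)/(11/10) m = 17/22 m, above 3/4 m. *)
have h7 : m - e <= lambda + 11 / 10 * t.
  by rewrite -(ler_pM2r (_ : 0 < dot x x)) ?xa// -xa (le_trans h4).
slra.
Qed.

Let G := U^T *m U.
Let symG : G^T = G. Proof. by rewrite /G trmx_mul trmxK. Qed.

(** A normalized null vector of G would be an eigenvector with t = 0, against the bound 3/4 m. *)
Lemma factor_gram_unit : G \in unitmx.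
Proof.
rewrite -row_full_unit /row_full; apply/negPn/negP => rG.
have [|a a0 Ga] := @kernel_vector _ _ _ G.
  by rewrite ltn_neqAle rG rank_leq_row.
have na : 0 < vec_norm a by rewrite lt0r vec_norm_eq0 a0 vec_norm_ge0.
have : 3 / 4 * m <= 0.
  apply: (@eigen_factor_ge ((vec_norm a)^-1 *: a)).
    by rewrite dotZl dotZr -sqr_vec_norm expr2 mulKf ?mulVf// gt_eqF.
  by rewrite -/G -scalemxAr Ga scaler0 scale0r.
slra.
Qed.

Lemma factor_gram_spectral : exists (W : 'M[R]_r) (mu : 'rV[R]_r),
  [/\ W^T *m W = 1%:M, forall j, 3 / 4 * m <= mu 0 j & G = W *m diag_mx mu *m W^T].
Proof.
have [W [mu [WW _ GE]]] := spectral_rank symG (mxrank_unit factor_gram_unit).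
exists W, mu; split => // j; apply: (@eigen_factor_ge (col j W)).
  by rewrite dot_col// eqxx.
by rewrite -/G GE spectral_col.
Qed.

Lemma factor_lower a : 3 / 4 * m * dot a a <= dot (U *m a) (U *m a).
Proof.
have [W [mu [WW muge GE]]] := factor_gram_spectral.
have WW' : W *m W^T = 1%:M by apply: mulmx1C.
rewrite dot_mulr mulmxA dotC -/G GE -!mulmxA (dot_mulr W).
set b := W^T *m a.
have -> : dot a a = dot b b by rewrite /b dot_mulr trmxK mulmxA WW' mul1mx.
clearbody b.
rewrite !dotE mulr_sumr; apply: ler_sum => j _.
rewrite mul_diag_mx !mxE [leRHS]mulrCA ler_wpM2r ?muge//.
by rewrite -expr2 sqr_ge0.
Qed.

Definition col_proj := U *m invmx G *m U^T.
Definition debiased := U *m U^T + lambda *: col_proj.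
Let P := col_proj.
Let D := debiased.

(** In an eigenbasis of G the matrix 1 + lambda G^(-1) has entries 1 + lambda/mu_j, nonnegative
    because mu_j >= 3/4 m and |lambda| <= m/20. So a root exists and the choice made by [psd_sqrt]
    is a genuine square root rather than its default 0. *)
Lemma debias_gram : debias lambda U *m (debias lambda U)^T = D.
Proof.
have [W [mu [WW muge GE]]] := factor_gram_spectral.
have WW' : W *m W^T = 1%:M by apply: mulmx1C.
have mup j : 0 < mu 0 j by apply: lt_le_trans (muge j); slra.
pose K := 1%:M + lambda *: invmx G.
have diagM (x y : 'rV[R]_r) : W *m diag_mx x *m W^T *m (W *m diag_mx y *m W^T) =
    W *m diag_mx (\row_j (x 0 j * y 0 j)) *m W^T.
  rewrite -!mulmxA (mulmxA W^T) WW mul1mx (mulmxA (diag_mx x)) mulmx_diag.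
  by congr (_ *m (diag_mx _ *m _)); apply/rowP => j; rewrite !mxE.
have GV : invmx G = W *m diag_mx (\row_j (mu 0 j)^-1) *m W^T.
  have h : G *m (W *m diag_mx (\row_j (mu 0 j)^-1) *m W^T) = 1%:M.
    rewrite GE diagM.
    have -> : diag_mx (\row_j (mu 0 j * (\row_j0 (mu 0 j0)^-1) 0 j)) = 1%:M :> 'M[R]_r.
      by apply/matrixP => i j; rewrite !mxE divff // gt_eqF.
    by rewrite mulmx1.
  by rewrite -[LHS]mulmx1 -h mulKmx ?factor_gram_unit.
pose k := \row_j (1 + lambda / mu 0 j).
have k0 j : 0 <= k 0 j.
  rewrite mxE -(divff (lt0r_neq0 (mup j))) -mulrDl divr_ge0 ?ltW//.
  by have := muge j; slra.
have KE : K = W *m diag_mx k *m W^T.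
  rewrite /K GV scalemxAl scalemxAr -{1}WW' -{1}(mulmx1 W) -mulmxDl -mulmxDr.
  congr (_ *m _ *m _); apply/matrixP => i j; rewrite !mxE.
  by case: eqP => _; rewrite ?mulr1n ?mulr0n ?mulr0 ?addr0.
have [sR [_ RR]] : (psd_sqrt K)^T = psd_sqrt K /\ psd (psd_sqrt K) /\
    psd_sqrt K *m psd_sqrt K = K.
  rewrite /psd_sqrt.
  apply: (@xgetPex _ 0 [set S : 'M[R]_r | S^T = S /\ psd S /\ S *m S = K]).
  exists (W *m diag_mx (\row_j Num.sqrt (k 0 j)) *m W^T); split.
    by rewrite !trmx_mul trmxK tr_diag_mx mulmxA.
  split; last first.
    rewrite diagM KE; congr (_ *m diag_mx _ *m _); apply/rowP => j.
    by have := k0 j; rewrite !mxE => kj; rewrite -expr2 sqr_sqrtr.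
  move=> x; rewrite -!mulmxA -/(dot _ _) dot_mulr dotE sumr_ge0// => j _.
  by rewrite mul_diag_mx !mxE mulrCA mulr_ge0 ?sqrtr_ge0// -expr2 sqr_ge0.
rewrite /debias -/G -/K trmx_mul sR mulmxA -(mulmxA U) RR /K /D /debiased /col_proj.
by rewrite mulmxDr mulmx1 mulmxDl -scalemxAr -scalemxAl.
Qed.

Lemma col_proj_tr : P^T = P.
Proof. by rewrite /P /col_proj !trmx_mul trmxK trmx_inv symG mulmxA. Qed.

Lemma col_proj_factor : P *m U = U.
Proof. by rewrite /P /col_proj -mulmxA mulmxKV ?factor_gram_unit. Qed.

Lemma col_projK : P *m P = P.
Proof. by rewrite {2}/P /col_proj !mulmxA col_proj_factor. Qed.

Lemma factor_col_proj : U^T *m P = U^T.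
Proof. by rewrite -[LHS]trmxK trmx_mul trmxK col_proj_tr col_proj_factor. Qed.

Lemma mul_col_proj : S *m P = D.
Proof.
rewrite /P /col_proj !mulmxA foc !mulmxDl mulmxK ?factor_gram_unit//.
by rewrite -!scalemxAl.
Qed.

Lemma debiased_tr : D^T = D.
Proof.
by rewrite /D /debiased linearD linearZ /= trmx_mul trmxK -/P col_proj_tr.
Qed.

Lemma col_proj_mul : P *m S = D.
Proof. by rewrite -[LHS]trmxK trmx_mul symS col_proj_tr mul_col_proj debiased_tr. Qed.

(** On the column space p.S p = |U^T p|^2 + lambda |p|^2. Writing p = U a, Cauchy-Schwarz gives
    |p|^4 <= |a|^2 |U^T p|^2 with |a|^2 <= |p|^2 / (3/4 m); and 7/10 = 3/4 - 1/20. *)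
Lemma col_proj_lower z : 7 / 10 * m * dot (P *m z) (P *m z) <=
  dot (P *m z) (S *m (P *m z)).
Proof.
set p := P *m z; pose a := invmx G *m (U^T *m z).
have pE : p = U *m a by rewrite /p /P /col_proj /a !mulmxA.
have -> : dot p (S *m p) = dot (U^T *m p) (U^T *m p) + lambda * dot p p.
  rewrite {2}pE mulmxA foc mulmxDl -scalemxAl -pE -!mulmxA -pE !dot_linE.
  by rewrite (dot_mulr U).
have h1 := factor_lower a; rewrite -pE in h1.
have h2 := dot_CS a (U^T *m p); rewrite dot_mulr trmxK -pE in h2.
have h3 := dot_ge0 a; have h4 := dot_ge0 (U^T *m p).
suff : 3 / 4 * m * dot p p <= dot (U^T *m p) (U^T *m p).
  have := dot_ge0 p; snra.
have [p0|p0] := eqVneq (dot p p) 0; first by rewrite p0 mulr0.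
have pp : 0 < dot p p by rewrite lt0r p0 dot_ge0.
rewrite -(ler_pM2r pp).
have : 3 / 4 * m * (dot p p ^+ 2) <= (3 / 4 * m * dot a a) * dot (U^T *m p) (U^T *m p).
  rewrite -[leRHS]mulrA ler_wpM2l//; slra.
have -> : 3 / 4 * m * dot p p * dot p p = 3 / 4 * m * dot p p ^+ 2 by ring.
by move=> /le_trans; apply; rewrite mulrC ler_wpM2l.
Qed.

(** The lower bound is positivity of M. For the upper one, the columns of U together with x give r +
    1 coefficients, so some nontrivial combination y = U a + b x is killed by V^T, hence by M, and
    y.S y <= e |y|^2. But S does not couple U a with x, its form on U a is at least 7/10 m |U a|^2,
    and it would exceed e |x|^2 at x: a contradiction whether or not b = 0. *)
Lemma perp_quad x : U^T *m x = 0 -> `|dot x (S *m x)| <= e * dot x x.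
Proof.
move=> Ux; rewrite ler_norml; apply/andP; split.
  have := S_M x; rewrite ler_norml => /andP[+ _]; have := psdM x; slra.
have [->|x0] := eqVneq x 0; first by rewrite mulmx0 dot0l mulr0.
have [//|lt] := leP (dot x (S *m x)) (e * dot x x).
have [|ab ab0] := @kernel_vector R r (r + 1) (V^T *m row_mx U x).
  by rewrite (leq_ltn_trans (rank_leq_row _))// addn1.
pose a := usubmx ab; pose b := dsubmx ab 0 0.
set y := U *m a + b *: x.
have yE : row_mx U x *m ab = y.
  rewrite -{1}[ab]vsubmxK mul_row_col /y; congr (_ + _).
  by rewrite [dsubmx ab]mx11_scalar mul_mx_scalar.
rewrite -mulmxA yE => Vy.
have Uax : dot (U *m a) x = 0 by rewrite dot_mull Ux dot0r.
have SUa : dot (S *m (U *m a)) x = 0.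
  rewrite mulmxA foc mulmxDl -scalemxAl -mulmxA !dot_linE Uax.
  by rewrite dot_mull Ux dot0r mulr0 addr0.
have ySy : dot y (S *m y) = dot (U *m a) (S *m (U *m a)) + b ^+ 2 * dot x (S *m x).
  rewrite /y mulmxDr -scalemxAr !dot_linE (dot_mulr S (U *m a) x) symS SUa.
  by rewrite (dotC x (S *m (U *m a))) SUa; ring.
have yy : dot y y = dot (U *m a) (U *m a) + b ^+ 2 * dot x x.
  by rewrite /y !dot_linE (dotC x) Uax; ring.
have hy := S_M y; rewrite M_perp// dot0r subr0 ler_norml in hy.
case/andP: hy => _ hy.
have ha := col_proj_lower (U *m a); rewrite [P *m _]mulmxA col_proj_factor in ha.
have la := factor_lower a.
exfalso; have [b0|b0] := eqVneq b 0.
  have a0 : a != 0.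
    apply: contraNneq ab0 => a0; rewrite -[ab]vsubmxK -/a a0.
    by rewrite [dsubmx ab]mx11_scalar -/b b0 -scalemx1 scale0r col_mx0.
  rewrite -dot_gt0 in a0; rewrite ySy yy b0 expr0n/= in hy.
  have : 0 < m * dot a a by rewrite mulr_gt0.
  have := dot_ge0 (U *m a); snra.
have b2 : 0 < b ^+ 2 by rewrite exprn_even_gt0.
have : b ^+ 2 * (e * dot x x) < b ^+ 2 * dot x (S *m x) by rewrite ltr_pM2l.
have := dot_ge0 (U *m a); rewrite ySy yy in hy; snra.
Qed.

Let Q := 1%:M - P.

Lemma compl_col_proj_op : op_norm (Q *m S *m Q) <= e.
Proof.
have sQ : Q^T = Q by rewrite /Q linearB /= trmx1 col_proj_tr.
apply: op_norm_sym_le => // [|x].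
  by rewrite !trmx_mul symS sQ mulmxA.
rewrite -!mulmxA (dot_mulr Q) sQ.
have UQ : U^T *m (Q *m x) = 0.
  by rewrite mulmxA /Q mulmxBr mulmx1 factor_col_proj subrr mul0mx.
apply: (le_trans (perp_quad UQ)); rewrite ler_wpM2l//.
have PQ : dot (P *m x) (Q *m x) = 0.
  by rewrite /P /col_proj -!mulmxA dot_mull UQ dot0r.
have -> : dot x x = dot (P *m x + Q *m x) (P *m x + Q *m x).
  by rewrite -mulmxDl addrC subrK mul1mx.
by rewrite !dot_linE (dotC (Q *m x) (P *m x)) PQ addr0 add0r lerDr dot_ge0.
Qed.

(** S commutes with P, so its off-diagonal blocks vanish and D is its block on the column space. *)
Lemma compl_col_projE : S - D = Q *m S *m Q.
Proof.
have DP : D *m P = D by rewrite -mul_col_proj -mulmxA col_projK.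
by rewrite /Q mulmxBr mulmx1 mulmxBl mul1mx col_proj_mul mulmxBl mul_col_proj DP subrr subr0.
Qed.

Lemma col_proj_op : op_norm P <= 1.
Proof. exact: op_norm_proj col_proj_tr col_projK. Qed.

Lemma debiased_op : op_norm (M - D) <= 2 * e.
Proof.
have -> : M - D = Q *m S *m Q - (S - M).
  by rewrite -compl_col_projE opprB [RHS]addrC subrKA.
rewrite (le_trans (op_normB _ _))//; have := compl_col_proj_op; have := SM => ? ?; slra.
Qed.

Lemma factor_op : op_norm (M - U *m U^T) <= 2 * e + `|lambda|.
Proof.
have -> : M - U *m U^T = (M - D) + lambda *: P.
  by rewrite /D /debiased opprD addrA subrK.
rewrite (le_trans (op_normD _ _))// lerD ?debiased_op//.
apply: op_norm_le => // v v1; rewrite -scalemxAl vec_normZ ler_piMr//.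
by rewrite (le_trans (op_norm_ub _ v1))// col_proj_op.
Qed.

Lemma debiased_rank : (\rank D <= r)%N.
Proof.
by rewrite -mul_col_proj /P /col_proj !mulmxA (leq_trans (mxrankM_maxr _ _))// rank_leq_row.
Qed.

Lemma one_point_summary :
  [/\ [/\ U^T *m U \in unitmx, P^T = P, P *m P = P & (\rank D <= r)%N],
      debias lambda U *m (debias lambda U)^T = D, D^T = D,
      S *m P = D /\ P *m S = D &
      [/\ forall z, 7 / 10 * m * dot (P *m z) (P *m z) <= dot (P *m z) (S *m (P *m z)),
          op_norm ((1%:M - P) *m S *m (1%:M - P)) <= e &
          op_norm (M - U *m U^T) <= 2 * e + `|lambda|]].
Proof.
split; [split|exact: debias_gram|exact: debiased_tr| |split].
- exact: factor_gram_unit.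
- exact: col_proj_tr.
- exact: col_projK.
- exact: debiased_rank.
- by split; [exact: mul_col_proj|exact: col_proj_mul].
- exact: col_proj_lower.
- exact: compl_col_proj_op.
- exact: factor_op.
Qed.

End one_point.

(** * Comparison of two critical points *)

Section invariant_subspaces.
Context {R : realType} {d : nat}.

Lemma op_norm_sandwich (A B C : 'M[R]_d) : op_norm A <= 1 -> op_norm C <= 1 ->
  op_norm (A *m B *m C) <= op_norm B.
Proof.
move=> A1 C1; apply: (le_trans (op_normM _ _)).
rewrite -[leRHS]mulr1 ler_pM ?op_norm_ge0//.
apply: (le_trans (op_normM _ _)).
by rewrite -[leRHS]mul1r ler_pM ?op_norm_ge0.
Qed.

Lemma compl_proj (P : 'M[R]_d) : P^T = P -> P *m P = P ->
  (1%:M - P)^T = 1%:M - P /\ (1%:M - P) *m (1%:M - P) = 1%:M - P.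
Proof.
move=> sP PP; split; first by rewrite linearB /= trmx1 sP.
by rewrite mulmxBl mul1mx mulmxBr mulmx1 PP subrr subr0.
Qed.

(* With [Q0 = 1 - P0], the identity [S (P Q0) - (P Q0) (Q0 S0 Q0) = P (S - S0) Q0]
   is a Sylvester equation whose two coefficients have separated spectra. *)
Lemma sylvester_bound (S S0 P P0 : 'M[R]_d) m : 0 < m ->
  P^T = P -> P *m P = P -> S *m P = P *m S ->
  P0^T = P0 -> P0 *m P0 = P0 -> S0 *m P0 = P0 *m S0 ->
  (forall z, 7 / 10 * m * dot (P *m z) (P *m z) <= dot (P *m z) (S *m (P *m z))) ->
  op_norm ((1%:M - P0) *m S0 *m (1%:M - P0)) <= m / 10 ->
  op_norm (S *m P *m (1%:M - P0)) <= 2 * op_norm (S - S0).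
Proof.
move=> m0 sP PP SP sP0 PP0 SP0 low hS0.
have [sQ QQ] := compl_proj sP0 PP0; set Q := 1%:M - P0 in sQ QQ hS0 *.
have SQ : S0 *m Q = Q *m S0.
  by rewrite /Q mulmxBl mulmxBr mul1mx mulmx1 SP0.
clearbody Q.
have E : S *m P *m Q = P *m Q *m (Q *m S0 *m Q) + P *m (S - S0) *m Q.
  have -> : P *m Q *m (Q *m S0 *m Q) = P *m S0 *m Q.
    by rewrite -!mulmxA (mulmxA Q Q) QQ (mulmxA Q S0) -SQ -(mulmxA S0) QQ.
  by rewrite SP mulmxBr mulmxBl addrC subrK.
have h1 : op_norm (S *m P *m Q) <= op_norm (P *m Q) * (m / 10) + op_norm (S - S0).
  rewrite E (le_trans (op_normD _ _))// lerD//.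
    by rewrite (le_trans (op_normM _ _))// ler_wpM2l ?op_norm_ge0.
  by apply: op_norm_sandwich; exact: op_norm_proj.
have h2 : 7 / 10 * m * op_norm (P *m Q) <= op_norm (S *m P *m Q).
  rewrite mulrC -ler_pdivlMr; last by lra.
  apply: op_norm_le => [|v v1]; first by rewrite divr_ge0 ?op_norm_ge0//; lra.
  rewrite ler_pdivlMr; last by lra.
  have [z0|z0] := eqVneq (vec_norm (P *m Q *m v)) 0.
    by rewrite z0 mul0r op_norm_ge0.
  have zp : 0 < vec_norm (P *m Q *m v) by rewrite lt0r z0 vec_norm_ge0.
  have := low (Q *m v); rewrite !mulmxA -sqr_vec_norm => h.
  have h' : dot (P *m Q *m v) (S *m P *m Q *m v) <=
      vec_norm (P *m Q *m v) * op_norm (S *m P *m Q).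
    apply: (le_trans (ler_norm _)); apply: (le_trans (dot_le _ _)).
    by rewrite ler_wpM2l ?vec_norm_ge0// op_norm_ub.
  by rewrite -(ler_pM2l zp); lra.
(* The two estimates give |S P Q| <= |S P Q|/7 + |S - S0|, hence the factor 7/6, rounded up to 2. *)
have := op_norm_ge0 (S - S0); lra.
Qed.

(** The difference splits as S P (1 - P0) - (S0 P0 (1 - P))^T + P (S - S0) P0. The Sylvester bound
    costs 2 for each of the first two terms and the last costs 1. Bounding S P - S0 P0 rather than P
    - P0 keeps the gap m out of the denominator. *)
Lemma invariant_perturbation (S S0 P P0 : 'M[R]_d) m : 0 < m ->
  S^T = S -> P^T = P -> P *m P = P -> S *m P = P *m S ->
  S0^T = S0 -> P0^T = P0 -> P0 *m P0 = P0 -> S0 *m P0 = P0 *m S0 ->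
  (forall z, 7 / 10 * m * dot (P *m z) (P *m z) <= dot (P *m z) (S *m (P *m z))) ->
  (forall z, 7 / 10 * m * dot (P0 *m z) (P0 *m z) <= dot (P0 *m z) (S0 *m (P0 *m z))) ->
  op_norm ((1%:M - P) *m S *m (1%:M - P)) <= m / 10 ->
  op_norm ((1%:M - P0) *m S0 *m (1%:M - P0)) <= m / 10 ->
  op_norm (S *m P - S0 *m P0) <= 5 * op_norm (S - S0).
Proof.
move=> m0 sS sP PP SP sS0 sP0 PP0 SP0 low low0 h h0.
have h1 := sylvester_bound m0 sP PP SP sP0 PP0 SP0 low h0.
have h2 := sylvester_bound m0 sP0 PP0 SP0 sP PP SP low0 h.
rewrite -(op_normN (S0 - S)) opprB in h2.
have -> : S *m P - S0 *m P0 = S *m P *m (1%:M - P0) -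
    (S0 *m P0 *m (1%:M - P))^T + P *m (S - S0) *m P0.
  rewrite trmx_mul (compl_proj sP PP).1 trmx_mul sS0 sP0 -SP0.
  rewrite mulmxBr mulmx1 mulmxBl mul1mx mulmxBr mulmxBl -SP !mulmxA.
  set a := S *m P; set b := a *m P0; set a0 := S0 *m P0; set b0 := P *m S0 *m P0.
  by apply/matrixP => i j; move: a b a0 b0 => a b a0 b0; rewrite !mxE; ring.
apply: (le_trans (op_normD _ _)); apply: (le_trans (lerD (op_normB _ _) (lexx _))).
rewrite op_norm_tr; have := op_norm_sandwich (S - S0) (op_norm_proj sP PP) (op_norm_proj sP0 PP0).
lra.
Qed.

End invariant_subspaces.

(** * Deterministic comparison under a good design *)

Section deterministic.
Context {R : realType} {d n r : nat}.
Variables (X : 'I_n -> 'M[R]_d) (eps : 'I_n -> R) (M : 'M[R]_d) (V : 'M[R]_(d, r)).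
Variables (m kappa eta nu : R).

Let c : R := (Num.sqrt n%:R)^-1.
Let y i := c * frob_inner (X i) M + eps i.

Definition noise_mx : 'M[R]_d := \sum_i (c * eps i) *: X i.

(** Everything the deterministic argument asks of the sample and the signal; m stands for lambda_r
    sqrt(d). The condition [gd_small] leaves m/20 for the Gram error, and nu + |lambda| <= m/20
    takes the other half of the budget m/10. *)
Record good_design : Prop := GoodDesign {
  gd_r : (0 < r)%N;
  gd_m : 0 < m;
  gd_kappa : 1 <= kappa;
  gd_eta : 0 <= eta;
  gd_nu : 0 <= nu;
  gd_sym : forall i, (X i)^T = X i;
  gd_rank1 : forall u v, `|dot v (gram_err X (u *m u^T) *m v)| <= eta * (dot u u * dot v v);
  gd_noise : forall z, `|dot z (noise_mx *m z)| <= nu * dot z z;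
  gd_VV : V^T *m V = 1%:M;
  gd_symM : M^T = M;
  gd_psdM : forall x, 0 <= dot x (M *m x);
  gd_lowM : forall a, m * dot a a <= dot (V *m a) (M *m (V *m a));
  gd_perpM : forall x : 'cV_d, V^T *m x = 0 -> M *m x = 0;
  gd_opM : op_norm M <= kappa * m;
  gd_rankM : (\rank M <= r)%N;
  gd_small : 2 * r%:R * eta * (4 * kappa + 1) <= 20^-1 }.

Definition surrogate (U : 'M[R]_(d, r)) := M + noise_mx + gram_err X (M - U *m U^T).

Hypothesis gd : good_design.

Let symN : noise_mx^T = noise_mx.
Proof.
rewrite /noise_mx linear_sum; apply: eq_bigr => i _.
by rewrite linearZ /= (gd_sym gd).
Qed.

Let opN : op_norm noise_mx <= nu.
Proof. exact: op_norm_sym_le (gd_nu gd) symN (gd_noise gd). Qed.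

Let rho := 2 * r%:R * eta.

Let rho0 : 0 <= rho.
Proof. by rewrite mulr_ge0 ?mulr_ge0// (gd_eta gd). Qed.

(** As kappa >= 1, the factor 4 kappa + 1 in [gd_small] is at least 5. *)
Let rho_le : rho <= 100^-1.
Proof.
have h := gd_small gd; have k1 := gd_kappa gd; have h0 := rho0; rewrite -/rho in h; nra.
Qed.

Let gram_err_diff (A B : 'M[R]_d) : A^T = A -> B^T = B -> (\rank A <= r)%N ->
  (\rank B <= r)%N -> op_norm (gram_err X (A - B)) <= rho * op_norm (A - B).
Proof.
move=> sA sB rA rB.
have : op_norm (gram_err X (A - B)) <= eta * (2 * r)%:R * op_norm (A - B).
  apply: (gram_err_op (gd_sym gd) (gd_eta gd) (gd_rank1 gd)).
    by rewrite linearB /= sA sB.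
  rewrite (leq_trans (mxrank_add _ _))// mul2n -addnn leq_add//.
  by rewrite mxrank_opp.
by rewrite /rho natrM (mulrC eta).
Qed.

Lemma outer_sym (U : 'M[R]_(d, r)) : (U *m U^T)^T = U *m U^T.
Proof. by rewrite trmx_mul trmxK. Qed.

Lemma outer_rank (U : 'M[R]_(d, r)) : (\rank (U *m U^T) <= r)%N.
Proof. by rewrite (leq_trans (mxrankM_maxl _ _))// rank_leq_col. Qed.

Let surrogate_sub U : op_norm (surrogate U - M) <= nu + rho * op_norm (M - U *m U^T).
Proof.
have -> : surrogate U - M = noise_mx + gram_err X (M - U *m U^T).
  by rewrite /surrogate; move: noise_mx (gram_err _ _) => A B; apply/matrixP => i j; rewrite !mxE; ring.
rewrite (le_trans (op_normD _ _))// lerD//.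
by rewrite gram_err_diff ?outer_sym ?outer_rank ?(gd_symM gd) ?(gd_rankM gd).
Qed.

Lemma surrogate_sym U : (surrogate U)^T = surrogate U.
Proof.
have sG : (gram_err X (M - U *m U^T))^T = gram_err X (M - U *m U^T).
  apply: gram_err_sym; first exact: gd_sym.
  by rewrite linearB /= outer_sym (gd_symM gd).
rewrite /surrogate; move: noise_mx symN (gram_err _ _) sG => A sA B sB.
by rewrite 2!linearD /= sB sA (gd_symM gd).
Qed.

Lemma residual_surrogate (U : 'M[R]_(d, r)) :
  residual_mx y X U = surrogate U - U *m U^T.
Proof.
have cc : c * c = n%:R^-1 by rewrite -invfM -expr2 sqr_sqrtr.
have -> : residual_mx y X U = gram X (M - U *m U^T) + noise_mx.
  rewrite /residual_mx /gram /noise_mx scaler_sumr -big_split /=.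
  apply: eq_bigr => i _; rewrite /residual /y -/c scalerA -cc -scalerDl.
  by congr (_ *: _); rewrite frob_innerDr frob_innerNr; ring.
rewrite /surrogate /gram_err; move: (gram X _) => A; move: (U *m U^T) => D.
move: noise_mx => B.
by apply/matrixP => i j; rewrite !mxE; ring.
Qed.

Section critical_point.
Variables (lambda : R) (U : 'M[R]_(d, r)).
Hypothesis lam_small : nu + `|lambda| <= m / 20.
Hypothesis crit : second_order_critical (lr_loss y X lambda) U.

Let S := surrogate U.

Lemma critical_foc : S *m U = U *m (U^T *m U) + lambda *: U.
Proof.
have := critical_residual (gd_sym gd) crit.
rewrite residual_surrogate mulmxBl -/S => <-.
by rewrite mulmxA addrC subrK.
Qed.

(** As U^T x = 0, the residual form at x is that of S, and x is orthogonal to U v; [gram_cross] with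
    eta <= 1/20 bounds the factor 2 (1/2 + eta) by 11/10. *)
Lemma critical_soc (x : 'cV[R]_d) (v : 'cV[R]_r) : U^T *m x = 0 -> dot v v = 1 ->
  dot x (S *m x) <= (lambda + 11 / 10 * dot (U *m v) (U *m v)) * dot x x.
Proof.
move=> Ux v1; have := critical_curvature (gd_sym gd) crit Ux v1.
rewrite residual_surrogate mulmxBl -mulmxA Ux mulmx0 subr0 -/S => /le_trans; apply.
have xU : dot x (U *m v) = 0 by rewrite dot_mulr Ux dot0l.
have := gram_cross (gd_sym gd) (gd_rank1 gd) xU.
have r1 : eta <= 20^-1.
  have h1 := rho_le; have h2 := gd_eta gd.
  have h3 : 1 <= r%:R :> R by rewrite ler1n (gd_r gd).
  rewrite /rho in h1; nra.
have h4 : 0 <= dot x x * dot (U *m v) (U *m v) by rewrite mulr_ge0 ?dot_ge0.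
by move=> h; nra.
Qed.

(** A priori bound that breaks the circular dependence of S on U. For A = U U^T the first-order
    condition gives (S - lambda) A = A^2, so |A| <= |S - lambda| <= |M| + nu + |lambda| + rho (|M| +
    |A|), and rho <= 1/100 absorbs |A|. *)
Lemma critical_outer_op : op_norm (U *m U^T) <= 2 * kappa * m.
Proof.
set A := U *m U^T; have s0 := op_norm_ge0 A.
have AA : (S - lambda%:M) *m A = A *m A.
  by rewrite /A mulmxA mulmxBl critical_foc mul_scalar_mx addrK !mulmxA.
have h1 : op_norm A ^+ 2 <= op_norm (S - lambda%:M) * op_norm A.
  by rewrite (le_trans (op_norm_sqr_sym (outer_sym U)))// -/A -AA op_normM.
have h2 : op_norm A <= op_norm (S - lambda%:M).
  have [->|A0] := eqVneq (op_norm A) 0; first exact: op_norm_ge0.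
  by rewrite -(ler_pM2r (_ : 0 < op_norm A)) -?expr2// lt0r A0.
have h3 := op_normB S lambda%:M; have h4 := @op_norm_scalar R d lambda.
have h5 : op_norm S <= op_norm (S - M) + op_norm M by rewrite -{1}(subrK M S) op_normD.
have h6 := surrogate_sub U; have h7 := gd_opM gd.
have h8 := op_normB M A; have h9 := rho_le; have h10 := rho0.
have h11 : rho * op_norm (M - A) <= 100^-1 * (kappa * m + op_norm A).
  by rewrite ler_pM ?op_norm_ge0// (le_trans h8)// lerD2r.
have h12 := gd_m gd; have h13 := gd_kappa gd; have h14 := lam_small.
have h15 : m <= kappa * m by rewrite ler_peMl// ltW.
rewrite -/S -/A in h6; lra.
Qed.

Lemma critical_surrogate_op : op_norm (S - M) <= m / 10.
Proof.
have h6 := surrogate_sub U; have h7 := gd_opM gd; have h1 := critical_outer_op.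
have h8 := op_normB M (U *m U^T); have h10 := rho0.
(* M contributes kappa m and U U^T contributes 2 kappa m; [gd_small] makes the product at most
   m/20. *)
have h11 : rho * op_norm (M - U *m U^T) <= rho * (3 * kappa * m).
  by rewrite ler_wpM2l//; lra.
have h12 := gd_m gd; have h14 := lam_small; have h15 := normr_ge0 lambda.
have h16 : rho * (4 * kappa + 1) * m <= 20^-1 * m.
  by rewrite ler_wpM2r ?(gd_small gd)// ltW.
rewrite -/S in h6; have h17 : 0 <= rho * m by rewrite mulr_ge0// ltW.
have h18 : 0 <= rho * kappa * m.
  exact: mulr_ge0 (mulr_ge0 rho0 (le_trans ler01 (gd_kappa gd))) (ltW h12).
lra.
Qed.

Let lam_m : `|lambda| <= m / 20.
Proof. by rewrite (le_trans _ lam_small)// lerDr (gd_nu gd). Qed.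

(** [lexx _] takes for e the actual norm of S - M instead of m/10; the resulting bounds are
    proportional to it, which lets the a priori estimate improve itself. *)
Let summary := one_point_summary (gd_m gd) (surrogate_sym U) (gd_VV gd)
  (gd_psdM gd) (gd_lowM gd) (gd_perpM gd) (lexx _) critical_surrogate_op lam_m
  critical_foc critical_soc.

(** |M - U U^T| <= 2 |S - M| + |lambda| and |S - M| <= nu + rho |M - U U^T|; since rho <= 1/100 the
    last term is absorbed on the left. *)
Lemma critical_factor_op : op_norm (M - U *m U^T) <= 4 * (nu + `|lambda|).
Proof.
have [_ _ _ _ [_ _ h1]] := summary.
have h2 := surrogate_sub U; have h3 := rho_le; have h4 := rho0; have h5 := gd_nu gd.
have h6 : rho * op_norm (M - U *m U^T) <= 100^-1 * op_norm (M - U *m U^T).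
  by rewrite ler_wpM2r ?op_norm_ge0.
rewrite -/S in h2; have := normr_ge0 lambda; lra.
Qed.

Lemma critical_summary : let P := col_proj U in let D := debiased U lambda in
  [/\ [/\ U^T *m U \in unitmx, P^T = P, P *m P = P & (\rank D <= r)%N],
      debias lambda U *m (debias lambda U)^T = D, D^T = D,
      S *m P = D /\ P *m S = D &
      (forall z, 7 / 10 * m * dot (P *m z) (P *m z) <= dot (P *m z) (S *m (P *m z))) /\
      op_norm ((1%:M - P) *m S *m (1%:M - P)) <= m / 10].
Proof.
have [h1 h2 h3 h4 [h5 h6 _]] := summary; split=> //; split => //.
by rewrite (le_trans h6)// critical_surrogate_op.
Qed.

End critical_point.

(** The undebiased point is the case lambda = 0 of the same analysis. The constant is 80 = 5 * 2 *
    8: 5 from [invariant_perturbation], 2 from the rank 2 r of a difference, 8 from two applications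
    of [critical_factor_op]; sqrt(2 r) passes to the Frobenius norm. *)
Theorem debias_deterministic lambda (U0 Ul : 'M[R]_(d, r)) :
  nu + `|lambda| <= m / 20 ->
  second_order_critical (lr_loss y X 0) U0 ->
  second_order_critical (lr_loss y X lambda) Ul ->
  Ul^T *m Ul \in unitmx /\
  frob_norm (debias lambda Ul *m (debias lambda Ul)^T - U0 *m U0^T) <=
    80 * Num.sqrt (2 * r)%:R * (r%:R * eta * (nu + `|lambda|)).
Proof.
move=> hl c0 cl.
have h0 : nu + `|0 : R| <= m / 20.
  by rewrite normr0 addr0 (le_trans _ hl)// lerDl.
have [[ul sP PP rD] -> sD [SP PS] [low perp]] := critical_summary hl cl.
have [[_ sP0 PP0 rD0] _ sD0 [SP0 PS0] [low0 perp0]] := critical_summary h0 c0.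
split => //.
have D0 : debiased U0 0 = U0 *m U0^T by rewrite /debiased scale0r addr0.
rewrite D0 in sD0 SP0 PS0 rD0.
set B := _ - _; have sB : B^T = B by rewrite /B linearB /= sD sD0.
have rB : (\rank B <= 2 * r)%N.
  by rewrite (leq_trans (mxrank_add _ _))// mul2n -addnn leq_add ?mxrank_opp.
apply: (le_trans (frob_norm_rank sB rB)).
rewrite mulrAC [leRHS]mulrC ler_wpM2l ?sqrtr_ge0//.
have hB : op_norm B <= 5 * op_norm (surrogate Ul - surrogate U0).
  rewrite /B -SP -SP0.
  exact: (invariant_perturbation (gd_m gd) (surrogate_sym Ul) sP PP (etrans SP (esym PS))
    (surrogate_sym U0) sP0 PP0 (etrans SP0 (esym PS0)) low low0 perp perp0).
have hS : surrogate Ul - surrogate U0 = gram_err X (U0 *m U0^T - Ul *m Ul^T).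
  have -> : U0 *m U0^T - Ul *m Ul^T = (M - Ul *m Ul^T) - (M - U0 *m U0^T).
    by rewrite opprB [RHS]addrC subrKA.
  by rewrite gram_errD gram_errN /surrogate opprD addrACA subrr add0r.
have hg := gram_err_diff (outer_sym U0) (outer_sym Ul) (outer_rank U0) (outer_rank Ul).
have hU : op_norm (U0 *m U0^T - Ul *m Ul^T) <= 8 * (nu + `|lambda|).
  have f0 := critical_factor_op h0 c0; have fl := critical_factor_op hl cl.
  have -> : U0 *m U0^T - Ul *m Ul^T = (M - Ul *m Ul^T) - (M - U0 *m U0^T).
    by rewrite opprB [RHS]addrC subrKA.
  rewrite normr0 addr0 in f0.
  have -> : 8 * (nu + `|lambda|) = 4 * (nu + `|lambda|) + 4 * (nu + `|lambda|) by ring.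
  apply: (le_trans (op_normB _ _)); apply: (lerD fl); apply: (le_trans f0).
  by rewrite ler_wpM2l// lerDl.
have hr : rho * op_norm (U0 *m U0^T - Ul *m Ul^T) <= rho * (8 * (nu + `|lambda|)).
  by rewrite ler_wpM2l// rho0.
have -> : 80 * (r%:R * eta * (nu + `|lambda|)) =
  5 * (rho * (8 * (nu + `|lambda|))) by rewrite /rho; ring.
by rewrite (le_trans hB)// hS ler_wpM2l// (le_trans hg).
Qed.

End deterministic.

(** * Integration against densities and independence *)

Section density_image.
Context d1 d2 (X : measurableType d1) (Y : measurableType d2) (R : realType).
Variables (mu : {measure set X -> \bar R}) (nu : {measure set Y -> \bar R}).
Variables (W : X -> R) (phi : X -> Y).
Hypothesis W0 : forall x, 0 <= W x.
Hypothesis mW : measurable_fun setT W.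
Hypothesis mphi : measurable_fun setT phi.
Hypothesis image : forall B, measurable B ->
  (\int[mu]_(x in phi @^-1` B) (W x)%:E = nu B)%E.

Import HBNNSimple.

Let mphiV B : measurable B -> measurable (phi @^-1` B).
Proof. by move=> mB; rewrite -(setTI (phi @^-1` B)); exact: mphi. Qed.

Let image_sfun (h : {nnsfun Y >-> R}) :
  (\int[nu]_y (h y)%:E = \int[mu]_x (W x * h (phi x))%:E)%E.
Proof.
under eq_integral do rewrite fimfunE -fsumEFin//.
rewrite ge0_integral_fsum//; last 2 first.
- by move=> y; exact/measurable_EFinP/measurable_funM.
- by move=> y x _; rewrite nnfun_muleindic_ge0.
have E x : (W x * h (phi x))%:E =
    (\sum_(k \in range h) (k * (W x * \1_(phi @^-1` (h @^-1` [set k])) x))%:E)%E.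
  rewrite [h (phi x)]fimfunE fsumEFin// mulr_fsumr//; congr EFin.
  by apply: eq_fsbigr => k _; rewrite mulrCA.
under [RHS]eq_integral do rewrite E.
rewrite ge0_integral_fsum//; last 2 first.
- move=> k; apply/measurable_EFinP; apply: measurable_funM => //.
  by apply: measurable_funM => //; apply: measurable_indic; exact: mphiV.
- move=> k x _; rewrite lee_fin; rewrite indicE; case: (boolP (_ \in _)); last by rewrite !mulr0.
  by rewrite inE => /= <-; rewrite mulr1 mulr_ge0.
apply: eq_fsbigr => k; rewrite inE => -[y _ hy].
have k0 : (0 <= k) by rewrite -hy.
rewrite integralZl_indic_nnsfun// integral_indic// setIT.
under [RHS]eq_integral do rewrite EFinM.
rewrite ge0_integralZl//; last 2 first.
- apply/measurable_EFinP/measurable_funM => //.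
  by apply: measurable_indic; exact: mphiV.
- by move=> x _; rewrite lee_fin mulr_ge0.
congr (_ * _)%E; rewrite -image//.
rewrite integral_mkcond; apply: eq_integral => x _.
by rewrite patchE indicE; case: ifPn => xk; rewrite ?(mulr1, mulr0).
Qed.

(** The hypothesis [image] is the case of indicators; simple functions and monotone convergence do
    the rest. W will be a density, the constant 1 (law of a variable), or the product of the other
    factors under independence. *)
Lemma ge0_integral_density_image (f : Y -> R) :
  (forall y, 0 <= f y) -> measurable_fun setT f ->
  (\int[nu]_y (f y)%:E = \int[mu]_x (W x * f (phi x))%:E)%E.
Proof.
move=> f0 mf.
have mf' : measurable_fun setT (EFin \o f) by exact/measurable_EFinP.
pose f_ := nnsfun_approx measurableT mf'.
have cf y : (EFin \o f_ ^~ y) @ \oo --> (f y)%:E.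
  by apply: (@cvg_nnsfun_approx _ _ _ _ measurableT _ mf') => // ? _; rewrite lee_fin.
transitivity (limn (fun n => \int[nu]_y (f_ n y)%:E))%E.
  rewrite -monotone_convergence//.
  - by apply: eq_integral => y _; apply/esym/cvg_lim => //; exact: cf.
  - by move=> n; exact/measurable_EFinP/measurable_funP.
  - by move=> n y _; rewrite lee_fin.
  - by move=> y _ m n mn; rewrite lee_fin; exact/lefP/nd_nnsfun_approx.
under eq_fun do rewrite image_sfun.
rewrite -monotone_convergence//.
- apply: eq_integral => x _; apply/cvg_lim => //.
  rewrite EFinM; under eq_fun do rewrite EFinM.
  by apply: cvgeZl => //; exact: cf.
- move=> n; apply/measurable_EFinP/measurable_funM => //.
  exact: measurableT_comp.
- by move=> n x _; rewrite lee_fin mulr_ge0.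
- move=> x _ m n mn; rewrite lee_fin ler_wpM2l//.
  exact/lefP/nd_nnsfun_approx.
Qed.

End density_image.

Section independence.
Context d (T : measurableType d) (R : realType) (P : probability T R).

Lemma measurable_prod_fun (I : eqType) (s : seq I) (p : pred I) (g : I -> T -> R) :
  (forall i, measurable_fun setT (g i)) ->
  measurable_fun setT (fun w => \prod_(i <- s | p i) g i w).
Proof.
move=> mg; elim: s => [|i s IH].
  by under eq_fun do rewrite big_nil; exact: measurable_cst.
under eq_fun do rewrite big_cons.
by case: (p i) => //; exact: measurable_funM.
Qed.

(* Independence gives the product formula for indicators; the factors are
   replaced by general nonnegative functions one index at a time. *)
Lemma independent_prod (I : finType) (Z : I -> T -> R) :
  mutually_independent P Z -> (forall i, measurable_fun setT (Z i)) ->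
  forall (g : I -> R -> R) (e : I -> R),
  (forall i x, 0 <= g i x) -> (forall i, measurable_fun setT (g i)) ->
  (forall i, (\int[P]_w (g i (Z i w))%:E = (e i)%:E)%E) ->
  (\int[P]_w (\prod_i g i (Z i w))%:E = (\prod_i e i)%:E)%E.
Proof.
move=> ind mZ g e g0 mg Eg.
have mgZ (h : I -> R -> R) i : measurable_fun setT (h i) ->
    measurable_fun setT (fun w => h i (Z i w)).
  by move=> mh; exact: measurableT_comp.
have mZV i B : measurable B -> measurable (Z i @^-1` B).
  by move=> mB; rewrite -(setTI (_ @^-1` _)); exact: mZ.
suff H (s : seq I) : forall (g : I -> R -> R) (e : I -> R),
    (forall i x, 0 <= g i x) -> (forall i, measurable_fun setT (g i)) ->
    (forall i, (\int[P]_w (g i (Z i w))%:E = (e i)%:E)%E) ->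
    (forall i, i \notin s -> exists2 B, measurable B & g i = \1_B) ->
    (\int[P]_w (\prod_i g i (Z i w))%:E = (\prod_i e i)%:E)%E.
  by apply: (H (enum I)) => // i; rewrite mem_enum.
elim: s => {g e g0 mg Eg} [|j s IH] g e g0 mg Eg gB.
  have /choice[B hB] : forall i, exists B, measurable B /\ g i = \1_B.
    by move=> i; have [//|B] := gB i; exists B.
  have eE i : P (Z i @^-1` B i) = (e i)%:E.
    rewrite -Eg (hB i).2 -[Z i @^-1` B i]setIT -integral_indic//.
    by apply: mZV; case: (hB i).
  have -> : (\prod_i e i)%:E = (\prod_i P (Z i @^-1` B i))%E.
    by rewrite -prodEFin; apply: eq_bigr => i _; rewrite eE.
  rewrite -ind; last by move=> i; case: (hB i).
  rewrite -[X in _ = P X]setIT -integral_indic//; last first.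
    by apply: fin_bigcap_measurable => // i _; apply: mZV; case: (hB i).
  apply: eq_integral => w _; congr EFin.
  rewrite indicE; case: (boolP (_ \in _)) => [|].
    rewrite inE => wB; apply: big1 => i _.
    by rewrite (hB i).2 indicE mem_set//; exact: (wB i).
  rewrite notin_setE => /existsNP[i] /not_implyP[_ wi].
  by rewrite (bigD1 i)//= (hB i).2 indicE memNset// mul0r.
pose W w := \prod_(i | i != j) g i (Z i w).
pose C := \prod_(i | i != j) e i.
have e0 i : 0 <= e i.
  by rewrite -lee_fin -Eg; apply: integral_ge0 => w _; rewrite lee_fin.
have C0 : 0 <= C by apply: prodr_ge0.
pose Zj : {mfun T >-> R} := HB.pack (Z j) (isMeasurableFun.Build _ _ _ _ _ (mZ j)).
(* The law of [Z j] scaled by C is the image under [Z j] of P weighted by W: on a set B this is the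
   induction hypothesis with the j-th factor replaced by the indicator of B. *)
pose law := mscale (NngNum C0) (distribution P Zj).
have main : (\int[law]_x (g j x)%:E = \int[P]_w (W w * g j (Z j w))%:E)%E.
  apply: ge0_integral_density_image => //.
  - by move=> w; apply: prodr_ge0.
  - by apply: measurable_prod_fun => i; exact: mgZ.
  move=> B mB.
  pose g' i := if i == j then \1_B else g i.
  pose e' i := if i == j then fine (P (Z j @^-1` B)) else e i.
  have := IH g' e'; rewrite (bigD1 j)//= [X in X * _]/e' eqxx.
  have -> : \prod_(i | i != j) e' i = C.
    by apply: eq_bigr => i /negPf ij; rewrite /e' ij.
  have EW w : \prod_i g' i (Z i w) = \1_(Z j @^-1` B) w * W w.
    rewrite (bigD1 j)//= {1}/g' eqxx; congr (_ * _).
    by apply: eq_bigr => i /negPf ij; rewrite /g' ij.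
  under eq_integral do rewrite EW.
  move=> h; rewrite /law /mscale /= /distribution /pushforward.
  rewrite integral_mkcond -[in RHS](@fineK _ (P (Z j @^-1` B))) ?fin_num_measure//; last exact: mZV.
  rewrite -EFinM mulrC -h.
  - apply: eq_integral => w _; rewrite patchE indicE.
    by case: ifPn => _; rewrite ?mul1r ?mul0r.
  - by move=> i x; rewrite /g'; case: ifP.
  - by move=> i; rewrite /g'; case: ifP => // _; exact: measurable_indic.
  - move=> i; rewrite /g' /e'; case: ifP => [/eqP ->|//].
    rewrite fineK ?fin_num_measure//; last exact: mZV.
    rewrite -[X in _ = P X]setIT -integral_indic//; exact: mZV.
  - move=> i si; rewrite /g'; case: eqP => [_|/eqP ij]; first by exists B.
    by apply: gB; rewrite inE negb_or ij.
under eq_integral do rewrite (bigD1 j)//= -/(W _) mulrC.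
rewrite -main ge0_integral_mscale//; last 2 first.
- exact/measurable_EFinP.
- by move=> x _; rewrite lee_fin.
rewrite (@ge0_integral_pushforward _ _ _ _ _ (Z j) (mZ j))//; last 2 first.
- exact/measurable_EFinP.
- by move=> x _; rewrite lee_fin.
by rewrite /= preimage_setT Eg (bigD1 j)//= -EFinM mulrC.
Qed.

End independence.

Section normal_moments.
Context {R : realType}.
Notation mu := (@lebesgue_measure R).

Lemma normal_prob_integral (m s : R) (f : R -> R) :
  (forall x, 0 <= f x) -> measurable_fun setT f ->
  (\int[normal_prob m s]_x (f x)%:E =
   \int[mu]_x (normal_pdf m s x * f x)%:E)%E.
Proof.
move=> f0 mf; apply: (@ge0_integral_density_image _ _ _ _ _ mu _ _ idfun) => //.
- by move=> x; exact: normal_pdf_ge0.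
- exact: measurable_normal_pdf.
- exact: measurable_id.
Qed.

Let pdfE (m s x : R) : s != 0 -> normal_pdf m s x =
  normal_peak s * expR (- (x - m) ^+ 2 / (s ^+ 2 *+ 2)).
Proof. by move=> s0; rewrite normal_pdfE. Qed.

(** Completing the square: exp(a x) times the N(0, s^2) density is a multiple of the N(a s^2, s^2)
    density. *)
Lemma normal_mgf (s a : R) : s != 0 ->
  (\int[normal_prob 0 s]_x (expR (a * x))%:E = (expR (a ^+ 2 * s ^+ 2 / 2))%:E)%E.
Proof.
move=> s0; rewrite normal_prob_integral//; last first.
  by apply: measurableT_comp => //; exact: measurable_funM.
have E x : normal_pdf 0 s x * expR (a * x) =
    expR (a ^+ 2 * s ^+ 2 / 2) * normal_pdf (a * s ^+ 2) s x.
  rewrite !pdfE// [RHS]mulrCA -[LHS]mulrA -!expRD.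
  by congr (_ * expR _); field.
under eq_integral do rewrite E EFinM.
rewrite ge0_integralZl//; last 2 first.
- by apply/measurable_EFinP; exact: measurable_normal_pdf.
- by move=> x _; rewrite lee_fin normal_pdf_ge0.
by rewrite integral_normal_pdf mule1.
Qed.

(** exp(t x^2) times the standard density is s times the N(0, s^2) density with s^2 = 1/(1 - 2
    t). *)
Lemma normal_square_mgf (t : R) : t < 2^-1 ->
  (\int[normal_prob 0 1]_x (expR (t * x ^+ 2))%:E = ((Num.sqrt (1 - 2 * t))^-1)%:E)%E.
Proof.
move=> t2; have tp : 0 < 1 - 2 * t by lra.
rewrite normal_prob_integral//; last first.
  by apply: measurableT_comp => //; apply: measurable_funM => //; exact: measurable_funX.
pose s := (Num.sqrt (1 - 2 * t))^-1.
have sp : 0 < s by rewrite invr_gt0 sqrtr_gt0.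
have s2 : s ^+ 2 = (1 - 2 * t)^-1 by rewrite exprVn sqr_sqrtr// ltW.
have E x : normal_pdf 0 1 x * expR (t * x ^+ 2) = s * normal_pdf 0 s x.
  rewrite !pdfE ?oner_eq0 ?gt_eqF// -[LHS]mulrA -expRD [RHS]mulrA.
  congr (_ * expR _); last first.
    rewrite s2 subr0; field; rewrite gt_eqF//.
  rewrite /normal_peak expr1n mul1r -[in RHS]mulrnAr sqrtrM ?sqr_ge0//.
  by rewrite sqrtr_sqr ger0_norm ?ltW// invfM mulVKf// gt_eqF.
under eq_integral do rewrite E EFinM.
rewrite ge0_integralZl//; last 3 first.
- by apply/measurable_EFinP; exact: measurable_normal_pdf.
- by move=> x _; rewrite lee_fin normal_pdf_ge0.
- by rewrite lee_fin ltW.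
by rewrite integral_normal_pdf mule1.
Qed.

End normal_moments.

(** * Squares of Gaussian linear forms *)

Section gaussian_quadratic.
Context d (T : measurableType d) (R : realType) (P : probability T R).
Variables (I : finType) (Z : I -> T -> R) (s2 : R).
Hypothesis mZ : forall i, measurable_fun setT (Z i).
Hypothesis s20 : 0 <= s2.
(** The family is i.i.d. N(0, s2), expressed through its joint Laplace transform, the form in which
    it is obtained for the GOE linear forms. *)
Hypothesis mgf : forall b : I -> R,
  (\int[P]_w (expR (\sum_i b i * Z i w))%:E = (expR (s2 / 2 * \sum_i b i ^+ 2))%:E)%E.

Lemma measurable_sum_fun (J : Type) (s : seq J) (g : J -> T -> R) :
  (forall i, measurable_fun setT (g i)) ->
  measurable_fun setT (fun w => \sum_(i <- s) g i w).
Proof.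
move=> mg; elim: s => [|i s IH].
  by under eq_fun do rewrite big_nil; exact: measurable_cst.
by under eq_fun do rewrite big_cons; exact: measurable_funD.
Qed.

Lemma measurable_expR_fun d' (T' : measurableType d') (g : T' -> R) :
  measurable_fun setT g -> measurable_fun setT (fun w => expR (g w)).
Proof. by move=> mg; apply: measurableT_comp. Qed.

(* Each [exp (th z^2)] is the average of [exp (sqrt (2 th) x z)] over a standard
   normal [x], which linearizes the exponent. *)
Lemma square_mgf (th : I -> R) : (forall i, 0 <= th i) ->
  (forall i, th i * s2 < 2^-1) ->
  (\int[P]_w (expR (\sum_i th i * Z i w ^+ 2))%:E =
   (\prod_i (Num.sqrt (1 - 2 * (th i * s2)))^-1)%:E)%E.
Proof.
move=> th0 ths.
pose q i := (Num.sqrt (1 - 2 * (th i * s2)))^-1.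
have q0 i : 0 <= q i by rewrite invr_ge0 sqrtr_ge0.
(* Mixed statement for the induction: indices in [s] carry squares, the others linear terms with
   arbitrary coefficients, so the new square at j can be traded for the linear coefficient
   [a * x]. *)
suff H (s : seq I) : forall b : I -> R,
   (\int[P]_w (expR (\sum_i (if i \in s then th i * Z i w ^+ 2 else b i * Z i w)))%:E =
   (\prod_i (if i \in s then q i else expR (s2 / 2 * b i ^+ 2)))%:E)%E.
  have := H (enum I) (fun=> 0).
  under eq_integral do under eq_bigr do rewrite mem_enum.
  by under [in RHS]eq_bigr do rewrite mem_enum.
elim: s => [|j s IH] b.
  rewrite -expR_sum -mulr_sumr -mgf.
  by apply: eq_integral => w _; do 2 congr EFin.
have [js|js] := boolP (j \in s).
  have E i : (i \in j :: s) = (i \in s) by rewrite inE; case: eqP => [->|].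
  under eq_integral do under eq_bigr do rewrite E.
  by under [in RHS]eq_bigr do rewrite E.
pose a := Num.sqrt (2 * th j).
have a2 : a ^+ 2 = 2 * th j by rewrite sqr_sqrtr// mulr_ge0.
pose rest w := \sum_(i | i != j) (if i \in s then th i * Z i w ^+ 2 else b i * Z i w).
have mrest : measurable_fun setT rest.
  rewrite /rest; under eq_fun do rewrite big_mkcond.
  apply: measurable_sum_fun => i; case: (i != j) => //; case: (i \in s).
    by apply: measurable_funM => //; exact: measurable_funX.
  exact: measurable_funM.
pose C := \prod_(i | i != j) (if i \in s then q i else expR (s2 / 2 * b i ^+ 2)).
pose F (z : T * R) := expR (a * Z j z.1 * z.2 + rest z.1).
have mF : measurable_fun setT F.
  apply: measurable_expR_fun; apply: measurable_funD; last exact: measurableT_comp.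
  apply: measurable_funM => //; apply: measurable_funM => //.
  exact: measurableT_comp.
have E w : (expR (\sum_i (if i \in j :: s then th i * Z i w ^+ 2 else b i * Z i w)))%:E =
    (\int[normal_prob 0 1]_x (F (w, x))%:E)%E.
  rewrite (bigD1 j)//= mem_head.
  have -> : \sum_(i | i != j) (if i \in j :: s then th i * Z i w ^+ 2 else b i * Z i w) = rest w.
    by apply: eq_bigr => i /negPf ij; rewrite inE ij.
  rewrite expRD /F /=.
  under [RHS]eq_integral do rewrite expRD EFinM.
  rewrite ge0_integralZr//; last first.
    by apply/measurable_EFinP; apply: measurable_expR_fun; exact: measurable_funM.
  rewrite normal_mgf ?oner_eq0// EFinM; congr (_%:E * _)%E; congr expR.
  by rewrite exprMn a2 expr1n; field.
under eq_integral do rewrite E.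
transitivity (\int[normal_prob 0 1]_x \int[P]_w (F (w, x))%:E)%E.
  apply: (@fubini_tonelli _ _ T (measurableTypeR R) R P (normal_prob 0 1)
    (fun z => (F z)%:E)); first exact/measurable_EFinP.
  by move=> z; rewrite lee_fin expR_ge0.
have G x : (\int[P]_w (F (w, x))%:E = (expR (th j * s2 * x ^+ 2))%:E * C%:E)%E.
  pose b' i := if i == j then a * x else b i.
  transitivity (\int[P]_w (expR (\sum_i (if i \in s then th i * Z i w ^+ 2 else b' i * Z i w)))%:E)%E.
    apply: eq_integral => w _; rewrite (bigD1 j)//= (negPf js) /b' eqxx /F /=.
    congr EFin; congr expR; congr (_ + _); first by rewrite mulrAC.
    by apply: eq_bigr => i /negPf ij; rewrite ij.
  rewrite IH (bigD1 j)//= (negPf js) /b' eqxx EFinM; congr (_%:E * _)%E.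
    by congr expR; rewrite exprMn a2; field.
  congr EFin; apply: eq_bigr => i /negPf ij; by rewrite ij.
under eq_integral do rewrite G.
rewrite ge0_integralZr//; last 2 first.
- apply/measurable_EFinP; apply: measurable_expR_fun.
  by apply: measurable_funM => //; exact: measurable_funX.
- rewrite lee_fin; apply: prodr_ge0 => i _.
  by case: ifP => // _; exact: expR_ge0.
rewrite normal_square_mgf ?ths// -EFinM (bigD1 j)//= mem_head; congr (_ * _)%:E.
by apply: eq_bigr => i /negPf ij; rewrite inE ij.
Qed.

Lemma markov_bound (A : set T) (g : T -> R) (v : R) : measurable A ->
  measurable_fun setT g -> (forall w, 0 <= g w) -> (forall w, A w -> 1 <= g w) ->
  (\int[P]_w (g w)%:E = v%:E)%E -> (P A <= v%:E)%E.
Proof.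
move=> mA mg g0 g1 <-; rewrite -[A in P A]setIT -integral_indic//.
apply: ge0_le_integral => //.
- exact/measurable_EFinP/measurable_indic.
- exact/measurable_EFinP.
- move=> w _; rewrite lee_fin indicE; case: (boolP (w \in A)) => //.
  by rewrite inE; exact: g1.
Qed.

Let S w := \sum_i Z i w ^+ 2.

Lemma measurable_sum_sqr : measurable_fun setT S.
Proof. by apply: measurable_sum_fun => i; exact: measurable_funX. Qed.

Let mSge c : measurable [set w | c <= S w].
Proof.
have -> : [set w | c <= S w] = setT `&` S @^-1` `[c, +oo[.
  by rewrite setTI; apply/seteqP; split => w /=; rewrite in_itv/= andbT.
by apply: measurable_sum_sqr => //; exact: measurable_itv.
Qed.

Let mSle c : measurable [set w | S w <= c].
Proof.
have -> : [set w | S w <= c] = setT `&` S @^-1` `]-oo, c].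
  by rewrite setTI; apply/seteqP; split => w /=; rewrite in_itv.
by apply: measurable_sum_sqr => //; exact: measurable_itv.
Qed.

(* [3 - 3 e^u + e^(2u)] agrees with [e^-u] to second order at [0] and dominates it
   for [u >= 0], so positive exponential moments also control the lower tail. *)
Lemma expRN_le (u : R) : 0 <= u -> expR (- u) <= 3 - 3 * expR u + expR (2 * u).
Proof.
move=> u0; have w1 : 1 <= expR u by rewrite -expR0 ler_expR.
have w0 : 0 < expR u by rewrite expR_gt0.
have -> : expR (2 * u) = expR u ^+ 2 by rewrite expRM_natl.
rewrite expRN -(ler_pM2r w0) mulVf ?gt_eqF//.
have : 0 <= (expR u - 1) ^+ 3 by rewrite exprn_ge0// subr_ge0.
move=> h; have -> : (3 - 3 * expR u + expR u ^+ 2) * expR u =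
  1 + (expR u - 1) ^+ 3 by ring.
by rewrite lerDl.
Qed.

(** The product of trinomials expands into a signed sum over maps from I to {0, 1, 2}; each term is
    a moment given by [square_mgf], and the sum of the values factorizes again. The condition on th
    covers the largest exponent, 2 th. *)
Lemma square_neg_mgf (th : R) : 0 <= th -> 2 * th * s2 < 2^-1 ->
  (\int[P]_w (\prod_i (3 - 3 * expR (th * Z i w ^+ 2) + expR (2 * (th * Z i w ^+ 2))))%:E
   = ((3 - 3 * (Num.sqrt (1 - 2 * (th * s2)))^-1 +
      (Num.sqrt (1 - 4 * (th * s2)))^-1) ^+ #|I|)%:E)%E.
Proof.
move=> th0 ths.
pose c (k : 'I_3) : R := nth 0 [:: 3; -3; 1] k.
have cE (x : R) : 3 - 3 * expR x + expR (2 * x) = \sum_k c k * expR (k%:R * x).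
  rewrite !big_ord_recl big_ord0 /c /= mul0r expR0 /bump /= !mulr1 mul1r addr0 mul1r.
  by rewrite mulNr addrA.
pose C (f : {ffun I -> 'I_3}) := \prod_i c (f i).
pose G (f : {ffun I -> 'I_3}) w := expR (\sum_i ((f i)%:R * th) * Z i w ^+ 2).
have prodE w : \prod_i (3 - 3 * expR (th * Z i w ^+ 2) + expR (2 * (th * Z i w ^+ 2))) =
    \sum_(f : {ffun I -> 'I_3}) C f * G f w.
  under eq_bigr do rewrite cE; rewrite bigA_distr_bigA; apply: eq_bigr => f _.
  rewrite big_split; congr (_ * _); rewrite /G expR_sum.
  by apply: eq_bigr => i _; rewrite mulrA.
have mG f : measurable_fun setT (G f).
  apply: measurable_expR_fun; apply: measurable_sum_fun => i.
  by apply: measurable_funM => //; exact: measurable_funX.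
have k2 (k : 'I_3) : k%:R <= 2 :> R by rewrite ler_nat -ltnS.
have ts0 : 0 <= th * s2 by rewrite mulr_ge0.
have EG f : (\int[P]_w (G f w)%:E =
    (\prod_i (Num.sqrt (1 - 2 * ((f i)%:R * th * s2)))^-1)%:E)%E.
  apply: square_mgf => i; first by rewrite mulr_ge0.
  by apply: le_lt_trans ths; rewrite -!mulrA ler_wpM2r.
have iG f : P.-integrable setT (EFin \o G f).
  apply/integrableP; split; first exact/measurable_EFinP.
  under eq_integral do rewrite /= ger0_norm ?expR_ge0//.
  by rewrite EG ltry.
under eq_integral do rewrite prodE -sumEFin.
rewrite integral_sum//; last first.
  move=> f; under eq_fun do rewrite EFinM; apply: integrableZl => //; exact: iG.
have -> : (\sum_(f : {ffun I -> 'I_3}) \int[P]_w (C f * G f w)%:E =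
   \sum_(f : {ffun I -> 'I_3}) (\prod_i (c (f i) * (Num.sqrt (1 - 2 * ((f i)%:R * th * s2)))^-1))%:E)%E.
  apply: eq_bigr => f _; under eq_integral do rewrite EFinM.
  by rewrite integralZl//; [rewrite EG -EFinM -big_split|exact: iG].
rewrite sumEFin -(bigA_distr_bigA (fun (i : I) (k : 'I_3) => c k * (Num.sqrt (1 - 2 * (k%:R * th * s2)))^-1)).
rewrite prodr_const; congr (_ ^+ _)%:E.
rewrite !big_ord_recl big_ord0 /c /= /bump /= !mul0r mulr0 subr0 sqrtr1 invr1 mulr1 addr0.
rewrite !mul1r mulNr addrA.
by have -> : 2 * ((1 + (1 + 0))%:R * th * s2) = 4 * (th * s2) by ring.
Qed.

(** After squaring, the claim is (1 - x)(1 + x/2 + x^2)^2 >= 1; the excess x^2 (5/4 (1 - x) - x^3)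
    is nonnegative for x <= 1/2. *)
Lemma inv_sqrt_le (x : R) : 0 <= x -> x <= 2^-1 ->
  (Num.sqrt (1 - x))^-1 <= 1 + x / 2 + x ^+ 2.
Proof.
move=> x0 x1; have y0 : 0 < 1 - x by lra.
have p0 : 0 < 1 + x / 2 + x ^+ 2 by have := sqr_ge0 x; lra.
rewrite -[leRHS]invrK lef_pV2 ?posrE ?invr_gt0 ?sqrtr_gt0//.
rewrite -[leLHS]ger0_norm ?invr_ge0 ?(ltW p0)// -sqrtr_sqr ler_sqrt; last exact: ltW.
rewrite exprVn -[leRHS]invrK lef_pV2 ?posrE ?invr_gt0 ?exprn_gt0//.
rewrite -(ler_pM2l y0) divff ?gt_eqF//.
have -> : (1 - x) * (1 + x / 2 + x ^+ 2) ^+ 2 =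
  1 + x ^+ 2 * (5 / 4 * (1 - x) - x ^+ 3) by field.
rewrite lerDl mulr_ge0 ?sqr_ge0//.
have : x ^+ 3 <= 2^-1 ^+ 3 by rewrite lerXn2r ?nnegrE ?invr_ge0.
lra.
Qed.

Lemma inv_sqrt_ge (x : R) : 0 <= x -> x < 1 -> 1 + x / 2 <= (Num.sqrt (1 - x))^-1.
Proof.
move=> x0 x1; have y0 : 0 < 1 - x by lra.
have p0 : 0 < 1 + x / 2 by lra.
rewrite -[leLHS]invrK lef_pV2 ?posrE ?invr_gt0 ?sqrtr_gt0//.
rewrite -[leRHS]ger0_norm ?invr_ge0 ?(ltW p0)// -sqrtr_sqr ler_sqrt ?sqr_ge0//.
rewrite exprVn -[leLHS]invrK lef_pV2 ?posrE ?invr_gt0 ?exprn_gt0//.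
rewrite -(ler_pM2l y0) divff ?gt_eqF//.
have -> : (1 - x) * (1 + x / 2) ^+ 2 = 1 - x ^+ 2 * (3 / 4 + x / 4) by field.
by rewrite gerBl mulr_ge0 ?sqr_ge0//; lra.
Qed.

Let n := #|I|.

Lemma sum_sqr_upper (t : R) : s2 <= 4 -> 0 < t -> t <= 1 ->
  (P [set w | n%:R * (s2 + 4 * t) <= S w]%R <= (expR (- (n%:R * t ^+ 2 / 64)))%:E)%E.
Proof.
(* With s2 <= 4 the Chernoff exponent per sample, 4 (th s2)^2 - 4 th t, is at most t^2/16 - t^2/8,
   below -t^2/64. *)
move=> s4 t0 t1; pose th := t / 32.
have th0 : 0 <= th by rewrite divr_ge0// ltW.
have ths : th * s2 <= 8^-1 by rewrite /th; nra.
have thsp : 0 <= th * s2 by rewrite mulr_ge0.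
pose q := (Num.sqrt (1 - 2 * (th * s2)))^-1.
have q0 : 0 <= q by rewrite invr_ge0 sqrtr_ge0.
have qle : q <= expR (th * s2 + 4 * (th * s2) ^+ 2).
  have h : 2 * (th * s2) <= 2^-1 by lra.
  apply: (le_trans (inv_sqrt_le _ h)); first by rewrite mulr_ge0.
  apply: le_trans (expR_ge1Dx _); lra.
apply: (@le_trans _ _ (expR (- th * (n%:R * (s2 + 4 * t))) * q ^+ n)%:E)%E.
  apply: (@markov_bound _ (fun w => expR (- th * (n%:R * (s2 + 4 * t))) *
    expR (\sum_i th * Z i w ^+ 2))).
  - exact: mSge.
  - apply: measurable_funM => //; apply: measurable_expR_fun.
    by apply: measurable_sum_fun => i; apply: measurable_funM => //; exact: measurable_funX.
  - by move=> w; rewrite mulr_ge0 ?expR_ge0.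
  - move=> w /= Sw; rewrite -expRD -mulr_sumr -[leLHS]expR0 ler_expR.
    by rewrite mulNr addrC subr_ge0 ler_wpM2l.
  under eq_integral do rewrite EFinM.
  rewrite ge0_integralZl//; last first.
    apply/measurable_EFinP; apply: measurable_expR_fun.
    by apply: measurable_sum_fun => i; apply: measurable_funM => //; exact: measurable_funX.
  rewrite square_mgf//; last by move=> _; lra.
  by rewrite prodr_const -EFinM.
rewrite lee_fin; apply: (@le_trans _ _ (expR (- th * (n%:R * (s2 + 4 * t))) *
   expR (th * s2 + 4 * (th * s2) ^+ 2) ^+ n)).
  rewrite ler_wpM2l ?expR_ge0// lerXn2r// nnegrE ?expR_ge0//.
rewrite -expRM_natl -expRD ler_expR.
have -> : - th * (n%:R * (s2 + 4 * t)) + n%:R * (th * s2 + 4 * (th * s2) ^+ 2) =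
  n%:R * (4 * (th * s2) ^+ 2 - 4 * th * t) by ring.
have -> : - (n%:R * t ^+ 2 / 64) = n%:R * (- (t ^+ 2 / 64)) by ring.
rewrite ler_wpM2l// /th.
have s216 : s2 ^+ 2 <= 16.
  by have h0 := s20; rewrite (_ : 16 = 4 ^+ 2) ?lerXn2r ?nnegrE//; ring.
have : 0 <= t ^+ 2 * (16 - s2 ^+ 2) by rewrite mulr_ge0 ?sqr_ge0 ?subr_ge0.
have := sqr_ge0 t; lra.
Qed.

Lemma sum_sqr_lower (t : R) : s2 <= 4 -> 0 < t -> t <= 1 ->
  (P [set w | S w <= n%:R * (s2 - 4 * t)]%R <= (expR (- (n%:R * t ^+ 2 / 64)))%:E)%E.
Proof.
(* The error is now 16 (th s2)^2, so th is four times smaller; t^2/64 - t^2/32 = -t^2/64 fixes the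
   constant 64 shared by both tails. *)
move=> s4 t0 t1; pose th := t / 128.
have th0 : 0 <= th by rewrite divr_ge0// ltW.
have ths : th * s2 <= 32^-1 by rewrite /th; nra.
have thsp : 0 <= th * s2 by rewrite mulr_ge0.
pose h (u : R) := 3 - 3 * expR u + expR (2 * u).
pose q := 3 - 3 * (Num.sqrt (1 - 2 * (th * s2)))^-1 + (Num.sqrt (1 - 4 * (th * s2)))^-1.
have h0 u : 0 <= u -> 0 <= h u by move=> u0; rewrite (le_trans _ (expRN_le u0)) ?expR_ge0.
have u0 i w : 0 <= th * Z i w ^+ 2 by rewrite mulr_ge0// sqr_ge0.
have qle : q <= expR (- (th * s2) + 16 * (th * s2) ^+ 2).
  have h2 : 2 * (th * s2) < 1 by lra.
  have h4 : 4 * (th * s2) <= 2^-1 by lra.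
  have p2 : 0 <= 2 * (th * s2) by lra.
  have p4 : 0 <= 4 * (th * s2) by lra.
  have i2 := inv_sqrt_ge p2 h2; have i4 := inv_sqrt_le p4 h4.
  apply: le_trans (expR_ge1Dx _); rewrite /q; lra.
have q0 : 0 <= q.
  have h2 : 2 * (th * s2) <= 2^-1 by lra.
  have h4 : 4 * (th * s2) < 1 by lra.
  have p2 : 0 <= 2 * (th * s2) by lra.
  have p4 : 0 <= 4 * (th * s2) by lra.
  have i2 := inv_sqrt_le p2 h2; have i4 := inv_sqrt_ge p4 h4.
  have : (th * s2) ^+ 2 <= 32^-1 * (th * s2) by rewrite expr2 ler_wpM2r.
  rewrite /q; lra.
have mh : measurable_fun setT (fun w => \prod_i h (th * Z i w ^+ 2)).
  apply: measurable_prod_fun => i.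
  have mu2 : measurable_fun setT (fun w => th * Z i w ^+ 2).
    by apply: measurable_funM => //; exact: measurable_funX.
  apply: measurable_funD; first apply: measurable_funB => //.
    by apply: measurable_funM => //; exact: measurable_expR_fun.
  by apply: measurable_expR_fun; exact: measurable_funM.
have hp w : 0 <= \prod_i h (th * Z i w ^+ 2) by apply: prodr_ge0 => i _; exact: h0.
have Eh := square_neg_mgf th0 (_ : 2 * th * s2 < 2^-1).
apply: (@le_trans _ _ (expR (th * (n%:R * (s2 - 4 * t))) * q ^+ n)%:E)%E.
  apply: (@markov_bound _ (fun w => expR (th * (n%:R * (s2 - 4 * t))) *
    \prod_i h (th * Z i w ^+ 2))).
  - exact: mSle.
  - exact: measurable_funM.
  - by move=> w; rewrite mulr_ge0 ?expR_ge0.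
  - move=> w /= Sw.
    apply: (@le_trans _ _ (expR (th * (n%:R * (s2 - 4 * t))) * \prod_i expR (- (th * Z i w ^+ 2)))).
      rewrite -expR_sum -expRD sumrN -mulr_sumr -[leLHS]expR0 ler_expR.
      by rewrite subr_ge0 ler_wpM2l.
    rewrite ler_wpM2l ?expR_ge0//; apply: ler_prod => i _.
    by rewrite expR_ge0 expRN_le.
  under eq_integral do rewrite EFinM.
  rewrite ge0_integralZl//; last 2 first.
  - exact/measurable_EFinP.
  - by move=> w _; rewrite lee_fin.
  by rewrite Eh//; lra.
rewrite lee_fin; apply: (@le_trans _ _ (expR (th * (n%:R * (s2 - 4 * t))) *
   expR (- (th * s2) + 16 * (th * s2) ^+ 2) ^+ n)).
  by rewrite ler_wpM2l ?expR_ge0// lerXn2r// nnegrE expR_ge0.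
rewrite -expRM_natl -expRD ler_expR.
have -> : th * (n%:R * (s2 - 4 * t)) + n%:R * (- (th * s2) + 16 * (th * s2) ^+ 2) =
  n%:R * (16 * (th * s2) ^+ 2 - 4 * th * t) by ring.
have -> : - (n%:R * t ^+ 2 / 64) = n%:R * (- (t ^+ 2 / 64)) by ring.
rewrite ler_wpM2l// /th.
have s216 : s2 ^+ 2 <= 16.
  by have h0' := s20; rewrite (_ : 16 = 4 ^+ 2) ?lerXn2r ?nnegrE//; ring.
have : 0 <= t ^+ 2 * (16 - s2 ^+ 2) by rewrite mulr_ge0 ?sqr_ge0 ?subr_ge0.
have := sqr_ge0 t; lra.
Qed.

Lemma sum_sqr_deviation (t : R) : s2 <= 4 -> 0 < t -> t <= 1 ->
  (P [set w | n%:R * (4 * t) <= `|S w - n%:R * s2|]%R <=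
    (2 * expR (- (n%:R * t ^+ 2 / 64)))%:E)%E.
Proof.
move=> s4 t0 t1.
have -> : [set w | n%:R * (4 * t) <= `|S w - n%:R * s2|] =
    [set w | n%:R * (s2 + 4 * t) <= S w] `|` [set w | S w <= n%:R * (s2 - 4 * t)].
  apply/seteqP; split => w /=.
    by rewrite ler_normr => /orP[h|h]; [left|right]; lra.
  by case=> h; rewrite ler_normr; apply/orP; [left|right]; lra.
apply: (le_trans (measureU2 P (mSge _) (mSle _))).
have -> : 2 * expR (- (n%:R * t ^+ 2 / 64)) =
  expR (- (n%:R * t ^+ 2 / 64)) + expR (- (n%:R * t ^+ 2 / 64)) by ring.
by rewrite EFinD leeD ?sum_sqr_upper ?sum_sqr_lower.
Qed.

End gaussian_quadratic.

(** * Nets of the unit ball *)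

Section nets.
Context {R : realType}.

Lemma sum_half_powers m : \sum_(k < m) (2 : R) ^- k <= 2.
Proof.
suff : \sum_(k < m) (2 : R) ^- k = 2 - 2 * 2 ^- m.
  by move=> ->; rewrite gerBl mulr_ge0 ?invr_ge0 ?exprn_ge0.
elim: m => [|m IH]; first by rewrite big_ord0 expr0 invr1 mulr1 subrr.
by rewrite big_ord_recr /= IH exprS invfM; field.
Qed.

(* Weighting [f] by [2 ^ (b - sum f)] makes the count a product over the
   coordinates. *)
Lemma card_bounded_sum (d m b : nat) (A : {set {ffun 'I_d -> bool * 'I_m}}) :
  (forall f : {ffun 'I_d -> bool * 'I_m}, f \in A -> (\sum_i (f i).2 <= b)%N) ->
  (#|A| <= 2 ^ (b + 2 * d))%N.
Proof.
move=> hA; rewrite -(ler_nat R).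
pose w (f : {ffun 'I_d -> bool * 'I_m}) : R := \prod_i 2 ^- (f i).2.
have w0 f : 0 <= w f by apply: prodr_ge0 => i _; rewrite invr_ge0 exprn_ge0.
have wE f : w f = 2 ^- (\sum_i (f i).2).
  by rewrite -exprVn -prodrXr; apply: eq_bigr => i _; rewrite exprVn.
have h1 : #|A|%:R <= \sum_(f in A) 2 ^+ b * w f.
  rewrite -sum1_card natr_sum; apply: ler_sum => f fA.
  rewrite wE ler_pdivlMr ?exprn_gt0// mul1r.
  by rewrite ler_eXn2l ?ltr1n// hA.
(* Each coordinate contributes two signs times a geometric sum of at most 2. *)
have h2 : \sum_f w f <= 4 ^+ d.
  have -> : \sum_f w f = \prod_(i < d) \sum_(p : bool * 'I_m) 2 ^- p.2.
    by rewrite bigA_distr_bigA.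
  rewrite prodr_const card_ord lerXn2r ?nnegrE//.
    by apply: sumr_ge0 => p _; rewrite invr_ge0 exprn_ge0.
  rewrite -(pair_bigA _ (fun (_ : bool) (k : 'I_m) => (2 : R) ^- k)) /=.
  by rewrite big_bool /=; have := sum_half_powers m; lra.
apply: (le_trans h1); rewrite -mulr_sumr natrX exprD exprM.
rewrite ler_wpM2l ?exprn_ge0//; apply: (@le_trans _ _ (\sum_f w f)).
  rewrite [leRHS](bigID (mem A)) /= lerDl.
  by apply: sumr_ge0.
by rewrite (le_trans h2)// (_ : 2 ^+ 2 = 4 :> R)// -natrX.
Qed.

(** Grid points of step h = 1/(4 sqrt d), stored as a sign and a magnitude per coordinate. Rounding
    towards zero stays in the ball and errs by at most d h^2 = 1/16 in squared norm. Points of the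
    ball have sum k_i^2 <= 16 d, hence sum k_i <= 16 d since k <= k^2 for naturals, and the count is
    at most 2^(16 d + 2 d). *)
Lemma ball_net (d : nat) : (0 < d)%N ->
  exists (F : finType) (v : F -> 'cV[R]_d),
    [/\ (#|F| <= 2 ^ (18 * d))%N, forall f, dot (v f) (v f) <= 1 &
      forall x, dot x x = 1 -> exists f, dot (x - v f) (x - v f) <= 16^-1].
Proof.
move=> d0; pose h : R := (4 * Num.sqrt d%:R)^-1.
have sd : 0 < Num.sqrt d%:R :> R by rewrite sqrtr_gt0 ltr0n.
have hp : 0 < h by rewrite invr_gt0 mulr_gt0.
have h2 : h ^+ 2 * d%:R = 16^-1.
  rewrite exprVn exprMn sqr_sqrtr// -natrX invfM mulfVK// gt_eqF// ltr0n //.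
pose F0 := {ffun 'I_d -> bool * 'I_(4 * d).+1}.
pose v0 (f : F0) : 'cV[R]_d := \col_i ((-1) ^+ (f i).1 * (f i).2%:R * h).
have v0E f : dot (v0 f) (v0 f) = h ^+ 2 * \sum_i (f i).2%:R ^+ 2.
  rewrite dotE mulr_sumr; apply: eq_bigr => i _; rewrite !mxE.
  by case: (f i).1; rewrite ?expr1 ?expr0; ring.
pose A : {set F0} := [set f : F0 | dot (v0 f) (v0 f) <= 1]%SET.
exists {f : F0 | f \in A}, (fun f => v0 (val f)); split.
- rewrite card_sig (_ : 18 * d = 16 * d + 2 * d)%N; last by rewrite -mulnDl.
  rewrite (eq_card (B := A)) => [|f]; last by rewrite inE.
  apply: card_bounded_sum => f; rewrite inE v0E => hf.
  rewrite -(ler_nat R) natr_sum.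
  apply: (@le_trans _ _ (\sum_i (f i).2%:R ^+ 2)).
    apply: ler_sum => i _; rewrite -natrX ler_nat.
    by case: (nat_of_ord (f i).2) => // k; rewrite leq_pmulr.
  rewrite natrM -(ler_pM2l (exprn_gt0 2 hp)) (le_trans hf)//.
  by rewrite mulrCA h2 mulfV.
- by case=> f /=; rewrite inE.
move=> x x1.
have xi i : `|x i 0| <= 1.
  rewrite -(@expr_le1 _ 2)// real_normK ?num_real// -x1 dotE (bigD1 i)//=.
  rewrite -expr2 lerDl; apply: sumr_ge0 => j _; rewrite -expr2 sqr_ge0 //.
pose k i := Num.truncn (`|x i 0| / h).
have kP i : (k i)%:R * h <= `|x i 0| < (k i).+1%:R * h.
  have /andP[k1 k2] : (k i)%:R <= `|x i 0| / h < (k i).+1%:R.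
    by apply: truncn_itv; rewrite divr_ge0// ltW.
  by rewrite -ler_pdivlMr// k1 -ltr_pdivrMr.
(* |x_i| <= 1 gives k <= 1/h = 4 sqrt(d) <= 4 d. *)
have kd i : (k i < (4 * d).+1)%N.
  rewrite ltnS -(ler_nat R); have /andP[k1 _] := kP i.
  have : (k i)%:R * h <= 1 := le_trans k1 (xi i).
  rewrite -ler_pdivlMr// div1r invrK => /le_trans; apply.
  rewrite natrM ler_wpM2l// -[leRHS]sqr_sqrtr// expr2 ler_peMr ?(ltW sd)//.
  by rewrite -[leLHS]sqrtr1 ler_sqrt ?ler1n// ler0n.
pose f : F0 := [ffun i => (x i 0 < 0, Ordinal (kd i))].
have vf i : v0 f i 0 = (-1) ^+ (x i 0 < 0)%R * ((k i)%:R * h).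
  by rewrite !mxE !ffunE /= mulrA.
have xs i : x i 0 = (-1) ^+ (x i 0 < 0)%R * `|x i 0|.
  case: ltP => x0; first by rewrite expr1 mulN1r ltr0_norm// opprK.
  by rewrite expr0 mul1r ger0_norm.
have fA : f \in A.
  rewrite inE -x1 !dotE; apply: ler_sum => i _.
  rewrite vf [X in _ <= X * _]xs [X in _ <= _ * X]xs -!expr2 !exprMn ler_wpM2l ?sqr_ge0//.
  have /andP[k1 _] := kP i; have k0 : 0 <= (k i)%:R * h by rewrite mulr_ge0// ltW.
  by rewrite -exprMn lerXn2r// nnegrE.
exists (exist _ f fA) => /=.
rewrite dotE -h2 mulr_natr -[X in _ *+ X]card_ord -sumr_const.
apply: ler_sum => i _.
have e : (x - v0 f) i 0 = (-1) ^+ (x i 0 < 0)%R * (`|x i 0| - (k i)%:R * h).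
  by rewrite [LHS]mxE [X in _ + X]mxE vf {1}xs mulrBr.
rewrite /= e -expr2 exprMn sqrr_sign mul1r.
have /andP[k1 k2] := kP i; rewrite -natr1 mulrDl mul1r in k2.
by rewrite lerXn2r ?nnegrE ?subr_ge0 ?(ltW hp)//; lra.
Qed.

(* For unit [x] and a net point [x'], [x^T W x - x'^T W x' = (x - x')^T W (x + x')]
   is at most [|W| / 2]. *)
Lemma net_op_norm (d : nat) (F : finType) (v : F -> 'cV[R]_d) (W : 'M[R]_d) a :
  (forall f, dot (v f) (v f) <= 1) ->
  (forall x, dot x x = 1 -> exists f, dot (x - v f) (x - v f) <= 16^-1) ->
  0 <= a -> W^T = W -> (forall f, `|dot (v f) (W *m v f)| <= a) ->
  op_norm W <= 2 * a.
Proof.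
move=> v1 net a0 sW hW.
have w0 := op_norm_ge0 W.
have unit x : dot x x = 1 -> `|dot x (W *m x)| <= a + op_norm W / 2.
  move=> x1; have [f hf] := net x x1.
  have e : dot x (W *m x) = dot (v f) (W *m v f) + dot (x - v f) (W *m (x + v f)).
    rewrite mulmxDr !dot_linE (dot_mulr W x (v f)) sW (dotC (W *m x)); ring.
  have n1 : vec_norm (x - v f) <= 4^-1.
    by rewrite vec_norm_le// (le_trans hf)// expr2 -invfM -natrM.
  have n2 : vec_norm (x + v f) <= 2.
    rewrite (le_trans (vec_normD _ _))// (_ : 2 = 1 + 1)// lerD//.
      by rewrite vec_norm_le// expr1n x1.
    by rewrite vec_norm_le// expr1n.
  rewrite e (le_trans (ler_normD _ _))// lerD// (le_trans (op_norm_dot _ _ _))//.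
  rewrite ler_wpM2l// (_ : 2^-1 = 4^-1 * 2); last by field.
  by rewrite ler_pM ?vec_norm_ge0.
suff : op_norm W <= a + op_norm W / 2 by lra.
apply: op_norm_sym_le => //; first by lra.
move=> x; have [->|x0] := eqVneq x 0.
  by rewrite mulmx0 dot0l normr0 mulr0.
have nx : 0 < vec_norm x by rewrite lt0r vec_norm_eq0 x0 vec_norm_ge0.
have u1 : dot ((vec_norm x)^-1 *: x) ((vec_norm x)^-1 *: x) = 1.
  by rewrite dotZl dotZr -sqr_vec_norm expr2 mulKf ?mulVf ?gt_eqF.
have := unit _ u1; rewrite -scalemxAr dotZl dotZr mulrA normrM.
rewrite ger0_norm ?mulr_ge0 ?invr_ge0 ?vec_norm_ge0// -invfM.
by rewrite ler_pdivrMl ?mulr_gt0// -expr2 sqr_vec_norm mulrC.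
Qed.

End nets.

(** * Linear forms in the GOE model *)

Section goe_forms.
Context {R : realType}.

Lemma sum_upper_triangle d (f : 'I_d -> 'I_d -> R) : (forall j k, f j k = f k j) ->
  \sum_j \sum_k f j k =
  \sum_(j < d) \sum_(k < d | (j <= k)%N) (if j == k then f j k else 2 * f j k).
Proof.
move=> sf.
have -> : \sum_j \sum_k f j k =
    \sum_(j < d) \sum_(k < d | (j <= k)%N) f j k + \sum_(j < d) \sum_(k < d | (k < j)%N) f j k.
  rewrite -big_split /=; apply: eq_bigr => j _.
  by rewrite (bigID (fun k : 'I_d => (j <= k)%N)) /=; congr (_ + _);
    apply: eq_bigl => k; rewrite -ltnNge.
have -> : \sum_(j < d) \sum_(k < d | (k < j)%N) f j k =
    \sum_(j < d) \sum_(k < d | (j <= k)%N) (if j == k then 0 else f j k).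
  rewrite (exchange_big_dep xpredT)//=; apply: eq_bigr => j _.
  rewrite [RHS]big_mkcond [LHS]big_mkcond /=; apply: eq_bigr => k _.
  by rewrite -val_eqE /=; case: ltngtP => // jk; rewrite sf.
rewrite -big_split /=; apply: eq_bigr => j _; rewrite -big_split /=.
by apply: eq_bigr => k _; case: ifP => _; ring.
Qed.

Lemma sum_goe_index n d (G : 'I_n -> 'I_d -> 'I_d -> R) :
  \sum_(x : goe_index n d) G (val x).1.1 (val x).1.2 (val x).2 =
  \sum_(i < n) \sum_(j < d) \sum_(k < d | (j <= k)%N) G i j k.
Proof.
rewrite pair_bigA /= pair_big_dep /=.
rewrite [RHS](reindex_omap (val : goe_index n d -> _) insub) /=; last first.
  by move=> [[i j] k] /= jk; rewrite insubT.
apply: eq_big => [[[[i j] k] jk]|[[[i j] k] jk] _] //=.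
by rewrite insubT jk /= eqxx.
Qed.

Section model.
Context dT (T : measurableType dT) (P : probability T R).
Variables (n d : nat) (sigma : R).
Variables (Xs : 'I_n -> 'I_d -> 'I_d -> T -> R) (eps : 'I_n -> T -> R).
Hypothesis sigma0 : 0 < sigma.
Hypothesis gm : goe_model P sigma Xs eps.

(** One family for both uses: beta = 0 yields the Gram error, and B = v v^T with beta = 1/sigma or
    -1/sigma yields the noise matrix by polarization. *)
Definition linear_form (B : 'M[R]_d) (beta : R) (i : 'I_n) (w : T) : R :=
  frob_inner (goe_mat Xs w i) B + beta * eps i w.

Let symXs i j k w : Xs i j k w = Xs i k j w. Proof. by case: gm. Qed.

Let law_diag i j : has_normal_law P 0 1 (Xs i j j).
Proof. by case: gm => _ [h _]; exact: h. Qed.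

Let law_off i (j k : 'I_d) : (j < k)%N -> has_normal_law P 0 (Num.sqrt 2^-1) (Xs i j k).
Proof. by case: gm => _ [_ [h _]]; exact: h. Qed.

Let law_eps i : has_normal_law P 0 sigma (eps i).
Proof. by case: gm => _ [_ [_ [h _]]]; exact: h. Qed.

Let mXs i j k : measurable_fun setT (Xs i j k).
Proof.
have [jk|kj|/val_inj ->] := ltngtP j k; last by case: (law_diag i k).
  by case: (law_off i jk).
have -> : Xs i j k = Xs i k j by apply/funext => w.
by case: (law_off i kj).
Qed.

Let meps i : measurable_fun setT (eps i).
Proof. by case: (law_eps i). Qed.

Lemma measurable_linear_form B beta i : measurable_fun setT (linear_form B beta i).
Proof.
apply: measurable_funD; last exact: measurable_funM.
rewrite /frob_inner; apply: measurable_sum_fun => j; apply: measurable_sum_fun => k.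
apply: measurable_funM => //; rewrite /goe_mat.
by under eq_fun do rewrite mxE; exact: mXs.
Qed.

Let normal_law_mgf s (Y : T -> R) a : s != 0 -> has_normal_law P 0 s Y ->
  (\int[P]_w (expR (a * Y w))%:E = (expR (a ^+ 2 * s ^+ 2 / 2))%:E)%E.
Proof.
move=> s0 [mY law]; rewrite -normal_mgf//.
transitivity (\int[P]_w (1 * expR (a * Y w))%:E)%E.
  by apply: eq_integral => w _; rewrite mul1r.
apply/esym; apply: (@ge0_integral_density_image _ _ T (measurableTypeR R) R P
  (normal_prob 0 s) (fun=> 1) Y _ _ _ _ (fun x => expR (a * x))) => //.
- move=> B mB; rewrite integral_cst ?mul1e//.
    exact: law.
  by rewrite -(setTI (Y @^-1` B)); exact: mY.
- by apply: measurable_expR_fun; exact: measurable_funM.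
Qed.

Let Y (z : goe_index n d + 'I_n) : T -> R :=
  match z with
  | inl x => Xs (val x).1.1 (val x).1.2 (val x).2
  | inr i => eps i
  end.

(** Coefficients of the independent variables in the sum of the b_i times the linear forms; an
    off-diagonal entry occurs twice in the symmetric matrix. *)
Let a (B : 'M[R]_d) (beta : R) (b : 'I_n -> R) (z : goe_index n d + 'I_n) : R :=
  match z with
  | inl x => b (val x).1.1 *
      (if (val x).1.2 == (val x).2 then 1 else 2) * B (val x).1.2 (val x).2
  | inr i => b i * beta
  end.

Let v (z : goe_index n d + 'I_n) : R :=
  match z with
  | inl x => if (val x).1.2 == (val x).2 then 1 else 2^-1
  | inr i => sigma ^+ 2
  end.

Let Y_mgf z c : (\int[P]_w (expR (c * Y z w))%:E = (expR (c ^+ 2 * v z / 2))%:E)%E.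
Proof.
case: z => [x|i] /=; last by apply: normal_law_mgf; rewrite ?gt_eqF.
case: x => -[[i j] k] /= jk.
have [e|njk] := eqVneq j k.
  by rewrite -e (@normal_law_mgf 1) ?oner_eq0 ?expr1n.
rewrite (@normal_law_mgf (Num.sqrt 2^-1)) ?sqr_sqrtr ?gt_eqF ?sqrtr_gt0//.
by apply: law_off; rewrite ltn_neqAle jk -val_eqE in njk *; rewrite njk.
Qed.

(** An off-diagonal entry has coefficient 2 B_jk and variance 1/2, so it contributes 2 B_jk^2,
    exactly its two occurrences in the squared Frobenius norm. *)
Lemma linear_form_mgf (B : 'M[R]_d) (beta : R) (b : 'I_n -> R) : B^T = B ->
  (\int[P]_w (expR (\sum_i b i * linear_form B beta i w))%:E =
   (expR ((frob_inner B B + beta ^+ 2 * sigma ^+ 2) / 2 * \sum_i b i ^+ 2))%:E)%E.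
Proof.
move=> sB; have sBij j k : B j k = B k j by rewrite -{1}sB mxE.
have E w : \sum_i b i * linear_form B beta i w = \sum_z a B beta b z * Y z w.
  rewrite big_sumType /= (sum_goe_index (fun i j k =>
    b i * (if j == k then 1 else 2) * B j k * Xs i j k w)).
  rewrite -big_split /=; apply: eq_bigr => i _.
  rewrite /linear_form mulrDr mulrA; congr (_ + _).
  rewrite /frob_inner (sum_upper_triangle (f := fun j k => goe_mat Xs w i j k * B j k)).
    rewrite mulr_sumr; apply: eq_bigr => j _; rewrite mulr_sumr.
    by apply: eq_bigr => k _; rewrite !mxE; case: ifP => _; ring.
  by move=> j k; rewrite !mxE sBij symXs.
have ind : mutually_independent P Y by case: gm => _ [_ [_ [_]]].
have mY z : measurable_fun setT (Y z) by case: z => /=.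
under eq_integral do rewrite E expR_sum.
rewrite (independent_prod ind mY (g := fun z x => expR (a B beta b z * x))
  (e := fun z => expR (a B beta b z ^+ 2 * v z / 2))).
- rewrite -expR_sum; congr (expR _)%:E.
  rewrite big_sumType /= (sum_goe_index (fun i j k =>
    (b i * (if j == k then 1 else 2) * B j k) ^+ 2 * (if j == k then 1 else 2^-1) / 2)).
  rewrite -big_split /= mulr_sumr; apply: eq_bigr => i _.
  rewrite /frob_inner (sum_upper_triangle (f := fun j k => B j k * B j k)); last first.
    by move=> j k; rewrite sBij.
  have -> : \sum_(j < d) \sum_(k < d | (j <= k)%N)
      (b i * (if j == k then 1 else 2) * B j k) ^+ 2 * (if j == k then 1 else 2^-1) / 2 =
    b i ^+ 2 / 2 * \sum_(j < d) \sum_(k < d | (j <= k)%N)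
      (if j == k then B j k * B j k else 2 * (B j k * B j k)).
    rewrite mulr_sumr; apply: eq_bigr => j _; rewrite mulr_sumr.
    by apply: eq_bigr => k _; case: ifP => _; field.
  by rewrite exprMn; ring.
- by move=> z x; exact: expR_ge0.
- by move=> z; apply: measurable_expR_fun; exact: measurable_funM.
- by move=> z; exact: Y_mgf.
Qed.

Lemma linear_form_deviation (B : 'M[R]_d) (beta t : R) : B^T = B ->
  frob_inner B B + beta ^+ 2 * sigma ^+ 2 <= 4 -> 0 < t -> t <= 1 ->
  (P [set w | n%:R * (4 * t) <= `|\sum_i linear_form B beta i w ^+ 2 -
      n%:R * (frob_inner B B + beta ^+ 2 * sigma ^+ 2)|]%R <=
   (2 * expR (- (n%:R * t ^+ 2 / 64)))%:E)%E.
Proof.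
move=> sB s4 t0 t1.
have := @sum_sqr_deviation _ T R P _ (linear_form B beta) _ _ _ _ t s4 t0 t1.
rewrite card_ord; apply.
- exact: measurable_linear_form.
- apply: addr_ge0; last by rewrite mulr_ge0 // sqr_ge0.
  by apply: sumr_ge0 => i _; apply: sumr_ge0 => j _; rewrite -expr2 sqr_ge0.
- by move=> b; exact: linear_form_mgf.
Qed.

Lemma measurable_deviation (B : 'M[R]_d) (beta c e : R) :
  measurable [set w | c <= `|\sum_i linear_form B beta i w ^+ 2 - e|].
Proof.
set g := fun w => `|\sum_i linear_form B beta i w ^+ 2 - e|.
have mg : measurable_fun setT g.
  apply: measurableT_comp => //; apply: measurable_funB => //.
  apply: measurable_sum_fun => i; apply: measurable_funX.
  exact: measurable_linear_form.
have -> : [set w | c <= g w] = setT `&` g @^-1` `[c, +oo[.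
  by rewrite setTI; apply/seteqP; split => w /=; rewrite in_itv/= andbT.
by apply: mg => //; exact: measurable_itv.
Qed.

End model.

End goe_forms.

(** * The high-probability event *)

Lemma union_bound (R : realType) dT (T : measurableType dT) (P : probability T R)
  (K : finType) (A : K -> set T) (p : R) :
  (forall k, measurable (A k)) -> (forall k, (P (A k) <= p%:E)%E) ->
  exists E, [/\ measurable E, ((1 - #|K|%:R * p)%:E <= P E)%E &
    forall w, E w -> forall k, ~ A k w].
Proof.
move=> mA PA; pose U (s : seq K) := \big[setU/set0]_(k <- s) A k.
have mU s : measurable (U s) by apply: bigsetU_measurable => k _.
have PU s : (P (U s) <= ((size s)%:R * p)%:E)%E.
  elim: s => [|k s IH]; first by rewrite /U big_nil measure0 mul0r.
  rewrite /U big_cons (le_trans (measureU2 P (mA k) (mU s)))//.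
  by rewrite /= -natr1 mulrDl mul1r addrC EFinD leeD //.
exists (~` U (enum K)); split; first exact: measurableC.
- rewrite probability_setC// EFinB leeB// cardE; exact: PU.
- move=> w /= nU k Ak; apply: nU.
  rewrite /U -(bigcup_seq (enum K)); exists k => //=; exact: mem_enum.
Qed.

Section good_event.
Context {R : realType} dT (T : measurableType dT) (P : probability T R).
Variables (n d : nat) (sigma t : R).
Variables (Xs : 'I_n -> 'I_d -> 'I_d -> T -> R) (eps : 'I_n -> T -> R).
Hypothesis sigma0 : 0 < sigma.
Hypothesis gm : goe_model P sigma Xs eps.
Hypotheses (n0 : (0 < n)%N) (d0 : (0 < d)%N) (t0 : 0 < t) (t1 : t <= 1).

Lemma goe_mat_sym w i : (goe_mat Xs w i)^T = goe_mat Xs w i.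
Proof. by case: gm => h _; apply/matrixP => j k; rewrite !mxE h. Qed.

Lemma linear_form_outer (a : 'cV[R]_d) i w :
  frob_inner (goe_mat Xs w i) (a *m a^T) = dot a (goe_mat Xs w i *m a).
Proof. exact: frob_inner_outer. Qed.

Lemma outer_inner (a b : 'cV[R]_d) : frob_inner (a *m a^T) (b *m b^T) = dot a b ^+ 2.
Proof.
by rewrite frob_inner_outer -mulmxA mulmx_scalar11 mul_mx_scalar dotZr (dotC b) expr2.
Qed.

Let nR : 0 < n%:R :> R. Proof. by rewrite ltr0n. Qed.

(** p q = ((p + q)^2 - (p - q)^2)/4: the common part s cancels, and two deviations of 4 n t leave 2
    t after division by 4 n. *)
Lemma polarization_bound (p q : 'I_n -> R) (s e : R) :
  `|\sum_i (p i + q i) ^+ 2 - n%:R * (s + 2 * e)| < n%:R * (4 * t) ->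
  `|\sum_i (p i - q i) ^+ 2 - n%:R * (s - 2 * e)| < n%:R * (4 * t) ->
  `|n%:R^-1 * (\sum_i p i * q i) - e| <= 2 * t.
Proof.
have E : n%:R^-1 * (\sum_i p i * q i) - e = n%:R^-1 * (4^-1 *
    ((\sum_i (p i + q i) ^+ 2 - n%:R * (s + 2 * e))
     - (\sum_i (p i - q i) ^+ 2 - n%:R * (s - 2 * e)))).
  have -> : \sum_i (p i + q i) ^+ 2 =
      \sum_i (p i - q i) ^+ 2 + 4 * \sum_i p i * q i.
    by rewrite mulr_sumr -big_split /=; apply: eq_bigr => i _; ring.
  by move: (n%:R) (lt0r_neq0 nR) => N N0; field.
rewrite E; set x := \sum_i (p i + q i) ^+ 2 - _; set y := \sum_i (p i - q i) ^+ 2 - _.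
clearbody x y; rewrite !ltr_norml => /andP[h1 h2] /andP[h3 h4].
rewrite normrM ger0_norm ?invr_ge0 ?ler0n// ler_pdivrMl// ler_norml.
by apply/andP; split; lra.
Qed.

(** Deviations are at most 2 t at net points, and each passage from the net to all vectors doubles
    the bound: twice for the Gram error (8 t), once for the noise (4 t). Pairs of net points account
    for 2^(36 d). *)
Lemma good_event : exists E : set T, [/\ measurable E,
  ((1 - 8 * (2 ^ (36 * d))%:R * expR (- (n%:R * t ^+ 2 / 64)))%:E <= P E)%E &
  forall w, E w ->
    (forall u v, `|dot v (gram_err (goe_mat Xs w) (u *m u^T) *m v)| <=
      8 * t * (dot u u * dot v v)) /\
    (forall z, `|dot z (noise_mx (goe_mat Xs w) (eps^~ w) *m z)| <=
      4 * t * sigma * Num.sqrt n%:R * dot z z)].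
Proof.
have [F [v [cF v1 net]]] := @ball_net R d d0.
(* Two net points for the Gram error, one for the noise; the boolean selects p + q or p - q in the
   polarization. *)
pose K : finType := ((F * F * bool) + (F * bool))%type.
pose B (k : K) : 'M[R]_d := match k with
  | inl (f, g, s) => v f *m (v f)^T + (-1) ^+ s *: (v g *m (v g)^T)
  | inr (f, _) => v f *m (v f)^T end.
pose beta (k : K) : R := match k with
  | inl _ => 0 | inr (_, s) => (-1) ^+ s * sigma^-1 end.
pose s2 k := frob_inner (B k) (B k) + beta k ^+ 2 * sigma ^+ 2.
pose A k := [set w | n%:R * (4 * t) <=
  `|\sum_i linear_form Xs eps (B k) (beta k) i w ^+ 2 - n%:R * s2 k|].
have symB k : (B k)^T = B k.
  by case: k => [[[f g] s]|[f s]] /=; rewrite ?linearD ?linearZ /= !trmx_mul !trmxK.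
have dot1 f g : dot (v f) (v g) ^+ 2 <= 1.
  by rewrite (le_trans (dot_CS _ _))// mulr_ile1 ?dot_ge0.
have s2E f g s : s2 (inl (f, g, s)) = (dot (v f) (v f) ^+ 2 + dot (v g) (v g) ^+ 2)
    + 2 * ((-1) ^+ s * dot (v f) (v g) ^+ 2).
  rewrite /s2 /= !frob_innerDl !frob_innerDr !frob_innerZl !frob_innerZr !outer_inner.
  rewrite (dotC (v g) (v f)) expr0n/= mul0r addr0.
  by case: s => /=; rewrite ?expr1 ?expr0; ring.
have s2E' f s : s2 (inr (f, s)) = dot (v f) (v f) ^+ 2 + 1.
  rewrite /s2 /= outer_inner exprMn sqrr_sign mul1r -exprMn mulVf ?expr1n//.
  by rewrite gt_eqF.
have s24 k : s2 k <= 4.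
  case: k => [[[f g] s]|[f s]]; last by rewrite s2E'; have := dot1 f f; lra.
  rewrite s2E; have := dot1 f f; have := dot1 g g; have := dot1 f g.
  by have := sqr_ge0 (dot (v f) (v g)); case: s => /=; rewrite ?expr1 ?expr0; lra.
have mA k : measurable (A k) by exact: measurable_deviation gm _ _ _ _.
have PA k : (P (A k) <= (2 * expR (- (n%:R * t ^+ 2 / 64)))%:E)%E.
  exact: (linear_form_deviation sigma0 gm (symB k) (s24 k) t0 t1).
have [E [mE PE EP]] := union_bound mA PA.
exists E; split => //.
  apply: le_trans PE; rewrite lee_fin lerD2l lerN2.
  (* There are 2 m^2 + 2 m events, at most 4 * 2^(36 d); the two tails double this to the factor
     8. *)
  have c1 : #|K|%:R <= 4 * (2 ^ (36 * d))%:R :> R.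
    rewrite -natrM ler_nat card_sum !card_prod card_bool.
    have -> : (36 * d = 18 * d + 18 * d)%N by rewrite -mulnDl.
    rewrite expnD; move: cF (expn_gt0 2 (18 * d)); set c := (2 ^ _)%N.
    set m := #|_| => mc c0.
    have m1 : (m * m <= c * c)%N by rewrite leq_mul.
    have m2 : (m <= c * c)%N by rewrite (leq_trans mc)// leq_pmulr.
    by rewrite (_ : 4 = 2 + 2)%N// mulnDl leq_add// mulnC leq_mul2l.
  rewrite mulrA ler_wpM2r ?expR_ge0//; lra.
move=> w Ew; set X := goe_mat Xs w.
have symX i : (X i)^T = X i := goe_mat_sym w i.
have dev k : `|\sum_i linear_form Xs eps (B k) (beta k) i w ^+ 2 - n%:R * s2 k| <
    n%:R * (4 * t).
  by rewrite ltNge; apply/negP; exact: EP.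
have small f g : `|dot (v g) (gram_err X (v f *m (v f)^T) *m v g)| <= 2 * t.
  have -> : dot (v g) (gram_err X (v f *m (v f)^T) *m v g) =
    n%:R^-1 * \sum_i dot (v f) (X i *m v f) * dot (v g) (X i *m v g) - dot (v f) (v g) ^+ 2.
    by rewrite gram_rank1 addrK.
  apply: (@polarization_bound _ _ (dot (v f) (v f) ^+ 2 + dot (v g) (v g) ^+ 2)).
    have := dev (inl (f, g, false)); rewrite s2E expr0 mul1r; congr (`|_ - _| < _).
    apply: eq_bigr => i _; rewrite /linear_form /= mul0r addr0 frob_innerDr scale1r.
    by rewrite !linear_form_outer.
  have := dev (inl (f, g, true)); rewrite s2E expr1 mulN1r mulrN; congr (`|_ - _| < _).
  apply: eq_bigr => i _; rewrite /linear_form /= mul0r addr0 frob_innerDr scaleN1r.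
  by rewrite frob_innerNr !linear_form_outer.
have t20 : 0 <= 2 * t by rewrite mulr_ge0// ltW.
split.
  move=> u z; rewrite -/X.
  have outS (x : 'cV[R]_d) : (x *m x^T)^T = x *m x^T by rewrite trmx_mul trmxK.
  have h1 f y : `|dot y (gram_err X (v f *m (v f)^T) *m y)| <= 4 * t * dot y y.
    have := net_op_norm v1 net t20 (gram_err_sym symX (outS (v f))) (small f).
    move=> h; rewrite (le_trans (op_norm_quad _ _))// ler_wpM2r ?dot_ge0//; lra.
  (* The symmetry in [gram_rank1] exchanges the two vectors, so the net argument can be run in the
     other one. *)
  have h2 f : `|dot (v f) (gram_err X (u *m u^T) *m v f)| <= 4 * t * dot u u.
    suff -> : dot (v f) (gram_err X (u *m u^T) *m v f) =
       dot u (gram_err X (v f *m (v f)^T) *m u) by exact: h1.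
    apply: (addIr (dot u (v f) ^+ 2)); rewrite -gram_rank1 (dotC u (v f)) -gram_rank1.
    by congr (_ * _); apply: eq_bigr => i _; rewrite mulrC.
  have p0 : 0 <= 4 * t * dot u u by rewrite mulr_ge0 ?dot_ge0// mulr_ge0// ltW.
  have := net_op_norm v1 net p0 (gram_err_sym symX (outS u)) h2.
  move=> h; rewrite (le_trans (op_norm_quad _ _))// mulrA ler_wpM2r ?dot_ge0//; lra.
move=> z; set N := noise_mx _ _.
have sN : N^T = N.
  by rewrite /N /noise_mx linear_sum; apply: eq_bigr => i _; rewrite linearZ /= symX.
have sn0 : 0 < Num.sqrt n%:R :> R by rewrite sqrtr_gt0.
have hN f : `|dot (v f) (N *m v f)| <= 2 * t * sigma * Num.sqrt n%:R.
  (* The noise form averages products of v.X_i v with the standardized noise; these have mean 0,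
     hence the target e = 0. *)
  have -> : dot (v f) (N *m v f) = sigma * Num.sqrt n%:R *
     (n%:R^-1 * \sum_i dot (v f) (X i *m v f) * (sigma^-1 * eps i w) - 0).
    rewrite /N /noise_mx mulmx_suml dot_sumr subr0 mulrA mulr_sumr.
    apply: eq_bigr => i _; rewrite -scalemxAl dotZr.
    have -> : n%:R^-1 = (Num.sqrt n%:R)^-1 ^+ 2 :> R by rewrite exprVn sqr_sqrtr.
    by field; rewrite !gt_eqF.
  rewrite normrM ger0_norm ?mulr_ge0 ?(ltW sigma0) ?(ltW sn0)//.
  rewrite -[leRHS]mulrA mulrC ler_wpM2r ?mulr_ge0 ?(ltW sigma0) ?(ltW sn0)//.
  apply: (@polarization_bound _ _ (dot (v f) (v f) ^+ 2 + 1)).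
    have := dev (inr (f, false)); rewrite s2E' mulr0 addr0; congr (`|_ - _| < _).
    by apply: eq_bigr => i _; rewrite /linear_form /= expr0 mul1r linear_form_outer.
  have := dev (inr (f, true)); rewrite s2E' mulr0 subr0; congr (`|_ - _| < _).
  by apply: eq_bigr => i _; rewrite /linear_form /= expr1 mulN1r mulNr linear_form_outer.
have p0 : 0 <= 2 * t * sigma * Num.sqrt n%:R.
  by rewrite !mulr_ge0 ?(ltW t0) ?(ltW sigma0) ?(ltW sn0).
have := net_op_norm v1 net p0 sN hN.
move=> h; rewrite (le_trans (op_norm_quad _ _))// ler_wpM2r ?dot_ge0//; lra.
Qed.

End good_event.

(** * The signal matrix *)

Section signal.
Context {R : realType} {d r : nat}.
Variables (V : 'M[R]_(d, r)) (lam : 'rV[R]_r).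
Hypothesis VV : V^T *m V = 1%:M.
Hypothesis lam0 : forall j, 0 < lam 0 j.

Let mu := min_entry (fun j => lam 0 j).
Let M := signal V lam.

Lemma min_entry_le j : mu <= lam 0 j.
Proof.
apply: ge_inf; last by exists j.
by exists 0 => _ [k _ <-]; exact: ltW.
Qed.

Lemma signal_quad x : dot x (M *m x) = Num.sqrt d%:R * \sum_j lam 0 j * (V^T *m x) j 0 ^+ 2.
Proof.
rewrite /M /signal -scalemxAl dotZr -!mulmxA dot_mulr; congr (_ * _).
rewrite dotE; apply: eq_bigr => j _.
by rewrite mul_diag_mx [X in _ * X]mxE; ring.
Qed.

Lemma signal_sym : M^T = M.
Proof. by rewrite /M /signal linearZ /= !trmx_mul trmxK tr_diag_mx mulmxA. Qed.

Lemma signal_psd x : 0 <= dot x (M *m x).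
Proof.
rewrite signal_quad mulr_ge0 ?sqrtr_ge0// sumr_ge0// => j _.
by rewrite mulr_ge0 ?sqr_ge0// ltW.
Qed.

Lemma signal_lower a : mu * Num.sqrt d%:R * dot a a <= dot (V *m a) (M *m (V *m a)).
Proof.
rewrite signal_quad mulmxA VV mul1mx dotE mulrAC mulrC ler_wpM2l ?sqrtr_ge0//.
rewrite mulr_sumr; apply: ler_sum => j _.
by rewrite -expr2 ler_wpM2r ?sqr_ge0 ?min_entry_le.
Qed.

Lemma signal_perp (x : 'cV[R]_d) : V^T *m x = 0 -> M *m x = 0.
Proof. by move=> Vx; rewrite /M /signal -scalemxAl -!mulmxA Vx !mulmx0 scaler0. Qed.

Lemma signal_rank : (\rank M <= r)%N.
Proof.
rewrite /M /signal (leq_trans (mxrank_scale _ _))// -mulmxA.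
by rewrite (leq_trans (mxrankM_maxl _ _))// rank_leq_col.
Qed.

End signal.

(** * Choice of the constants and conclusion *)

Theorem theorem7 (R : realType) :
  forall (kappa C4 C5 sigma_min : R), 0 < sigma_min ->
  exists C1_0 : R, forall C1 C2 : R, C1_0 <= C1 ->
  exists C3_0 : R, forall C3 : R, C3_0 <= C3 ->
  exists C c : R, 0 < C /\ 0 < c /\
  forall (d n r : nat) (sigma lambda : R) (V : 'M[R]_(d, r)) (lam : 'rV[R]_r)
    (dT : measure_display) (T : measurableType dT) (P : probability T R)
    (Xs : 'I_n -> 'I_d -> 'I_d -> T -> R) (eps : 'I_n -> T -> R),
    (0 < d)%N -> (0 < n)%N -> (0 < r)%N -> 0 < sigma ->
    (* Assumption 1 *)
    V^T *m V = 1%:M ->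
    (forall j, 0 < lam 0 j) ->
    C1 * Num.sqrt r%:R < min_entry (fun j => lam 0 j) / sigma < C2 * Num.sqrt r%:R ->
    op_norm (signal V lam) / (min_entry (fun j => lam 0 j) * Num.sqrt d%:R) <= kappa ->
    sigma_min <= sigma ->
    (* Assumption 2: gamma_n = n / (d r) >= C3 r *)
    C3 * r%:R <= n%:R / (d%:R * r%:R) ->
    (* Assumption 3 *)
    C4 * Num.sqrt d%:R <= lambda / sigma <= C5 * Num.sqrt d%:R ->
    (* the observation model *)
    goe_model P sigma Xs eps ->
    exists E : set T, measurable E /\
      ((1 - C * (expR (- c * (d%:R * r%:R)) + expR (- c * n%:R) + expR (- c * d%:R)))%:E
         <= P E)%E /\
      forall w, E w ->
      forall U0 Ul : 'M[R]_(d, r),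
        second_order_critical
          (lr_loss (response (signal V lam) Xs eps w) (goe_mat Xs w) 0) U0 ->
        second_order_critical
          (lr_loss (response (signal V lam) Xs eps w) (goe_mat Xs w) lambda) Ul ->
        (Ul^T *m Ul) \in unitmx /\
        (Num.sqrt (d%:R * r%:R))^-1 *
          frob_norm (debias lambda Ul *m (debias lambda Ul)^T - U0 *m U0^T)
        <= C * (sigma * r%:R * Num.sqrt (d%:R / n%:R)).
Proof.
move=> kappa C4 C5 sigma_min _.
(* L gives |lambda| <= L sigma sqrt(d) whatever the signs of C4 and C5; k1 meets the requirement
   [gd_kappa]. *)
pose L := `|C4| + `|C5|; pose k1 := Num.max kappa 1.
have L0 : 0 <= L by rewrite addr_ge0.
have k1_1 : 1 <= k1 by rewrite le_max lexx orbT.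
(* Chosen so that nu + |lambda| <= (196 + L) sigma sqrt(d) is at most m/20; here nu = 196 sigma
   sqrt(d) with 196 = 4 * 49. *)
exists (20 * (196 + L)) => C1 C2 hC1.
(* With g = sqrt(d/n) and eta = 8 * 49 g = 392 g, the left side of [gd_small] is q r g / 20. *)
pose q := (40 * 392) * (4 * k1 + 1); have q0 : 0 < q by rewrite /q; lra.
have qE : q = 40 * 392 * (4 * k1 + 1) by []; clearbody q.
(* Since C3 (r g)^2 <= 1, the first bound gives t = 49 g <= 1 and the second q r g <= 1. *)
exists (Num.max (49 ^+ 2) (q ^+ 2)) => C3; rewrite ge_max => /andP[hC3 hC3q].
(* 160 is 80 times 2, from sqrt(2 r) <= 2 sqrt(r); the other factors are eta/g and (nu +
   |lambda|)/(sigma sqrt d). *)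
exists ((160 * 392) * (196 + L)), 1; split; first by lra.
split => // d n r sigma lambda V lam dT T P Xs eps d0 n0 r0 sigma0 VV lam0.
set mu := min_entry _ => /andP[mu1 _] hkappa _ hn /andP[l1 l2] gm.
have dR : 0 < d%:R :> R by rewrite ltr0n.
have nR : 0 < n%:R :> R by rewrite ltr0n.
have rR : 0 < r%:R :> R by rewrite ltr0n.
have r1 : 1 <= r%:R :> R by rewrite ler1n.
pose sd := Num.sqrt (d%:R : R); have sd0 : 0 < sd by rewrite sqrtr_gt0.
pose g := Num.sqrt (d%:R / n%:R : R).
have g0 : 0 < g by rewrite sqrtr_gt0 divr_gt0.
have g2 : g ^+ 2 * n%:R = d%:R :> R by rewrite sqr_sqrtr ?divr_ge0 ?ler0n// divfK ?gt_eqF.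
have gn : g * Num.sqrt n%:R = sd.
  by rewrite -sqrtrM ?divr_ge0 ?ler0n// divfK ?gt_eqF.
have gE : g = Num.sqrt (d%:R / n%:R) by [].
have sdE : sd = Num.sqrt d%:R by []; clearbody g sd.
have hn' : C3 * r%:R ^+ 2 * d%:R <= n%:R.
  move: hn; rewrite ler_pdivlMr ?mulr_gt0//; lra.
have rg : C3 * (r%:R * g) ^+ 2 <= 1.
  have e : (r%:R * g) ^+ 2 * n%:R = r%:R ^+ 2 * d%:R by rewrite exprMn -mulrA g2.
  by rewrite -(ler_pM2r nR) mul1r -mulrA e mulrA.
have C30 : 0 < C3 by lra.
(* n t^2 / 64 = 49^2/64 d exceeds 37 d, which beats the 2^(36 d) net pairs with exp(-d) to spare. *)
pose t := 49 * g; have t0 : 0 < t by rewrite /t; lra.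
have tE : t = 49 * g by []; clearbody t.
have g249 : g <= 49^-1.
  rewrite -(@ler_pXn2r _ 2) ?nnegrE ?invr_ge0 ?(ltW g0)//.
  have h : g ^+ 2 <= (r%:R * g) ^+ 2.
    by rewrite lerXn2r ?nnegrE ?mulr_ge0 ?(ltW g0)// ler_peMl ?(ltW g0).
  have h' : (49 ^+ 2) * g ^+ 2 <= 1.
    apply: le_trans rg; apply: ler_pM => //; first by rewrite sqr_ge0.
  lra.
have t1 : t <= 1 by rewrite tE; lra.
have rgq : q * (r%:R * g) <= 1.
  have p0 := mulr_ge0 (ltW q0) (mulr_ge0 (ltW rR) (ltW g0)).
  rewrite -(@expr_le1 _ 2 _ isT p0) exprMn.
  by apply: le_trans rg; rewrite ler_wpM2r ?sqr_ge0.
have mu_sigma : 20 * (196 + L) * sigma <= mu.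
  have : C1 * Num.sqrt r%:R <= mu / sigma := ltW mu1.
  rewrite ler_pdivlMr// => /(le_trans _); apply; rewrite ler_wpM2r ?(ltW sigma0)//.
  have C10 : 0 <= C1 by lra.
  have sr1 : 1 <= Num.sqrt r%:R :> R by rewrite -[leLHS]sqrtr1 ler_sqrt// ltW.
  by rewrite (le_trans hC1)// ler_peMr.
have mu0 : 0 < mu by apply: lt_le_trans mu_sigma; rewrite mulr_gt0//; lra.
have lamL : `|lambda| <= L * sigma * sd.
  move: l1 l2; rewrite ler_pdivlMr// ler_pdivrMr// -sdE => l1 l2.
  have s0 : 0 <= sigma * sd by rewrite mulr_ge0 ?(ltW sd0) ?(ltW sigma0).
  have a4 : - `|C4| * (sigma * sd) <= C4 * (sigma * sd).
    by rewrite ler_wpM2r//; have := ler_norm (- C4); rewrite normrN; lra.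
  have a5 : C5 * (sigma * sd) <= `|C5| * (sigma * sd).
    by rewrite ler_wpM2r// ler_norm.
  have b4 : 0 <= `|C4| * (sigma * sd) by rewrite mulr_ge0.
  have b5 : 0 <= `|C5| * (sigma * sd) by rewrite mulr_ge0.
  by rewrite ler_norml /L; apply/andP; split; lra.
have [E [mE PE EP]] := good_event sigma0 gm n0 d0 t0 t1.
exists E; split => //; split.
  apply: le_trans PE; rewrite lee_fin lerD2l lerN2.
  have -> : n%:R * t ^+ 2 / 64 = (49 ^+ 2) / 64 * d%:R by rewrite -g2 tE; field.
  have h2 : (2 ^ (36 * d))%:R <= expR (36 * d%:R) :> R.
    rewrite natrX -natrM -[X in expR X]mulr1 expRM_natl.
    rewrite lerXn2r ?nnegrE ?expR_ge0//.
    by have := expR_ge1Dx (1 : R).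
  have h3 : expR (36 * d%:R) * expR (- ((49 ^+ 2) / 64 * d%:R)) <= expR (- 1 * d%:R) :> R.
    by rewrite -expRD ler_expR; lra.
  have h4 : (2 ^ (36 * d))%:R * expR (- ((49 ^+ 2) / 64 * d%:R)) <= expR (- 1 * d%:R) :> R.
    by apply: le_trans h3; rewrite ler_wpM2r ?expR_ge0.
  have e1 := expR_ge0 (- 1 * (d%:R * r%:R) : R).
  have e2 := expR_ge0 (- 1 * n%:R : R); have e3 := expR_ge0 (- 1 * d%:R : R).
  set a := expR (_ * (_ * _)) in e1 *; set b := expR (- 1 * n%:R) in e2 *.
  set e := expR (- 1 * d%:R) in e3 h4 *.
  (* The failure probability is at most 8 exp(-d), and the coefficient 160 * 392 * (196 + L) exceeds
     8. *)
  have : 0 <= L * (a + b + e) by rewrite mulr_ge0 ?addr_ge0.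
  lra.
move=> w Ew U0 Ul c0 cl; have [rank1 noise] := EP w Ew.
have gd : good_design (goe_mat Xs w) (eps^~ w) (signal V lam) V (mu * sd) k1
    (8 * t) (4 * t * sigma * Num.sqrt n%:R).
  split => //.
  - exact: mulr_gt0.
  - by rewrite mulr_ge0// ltW.
  - by rewrite !mulr_ge0 ?(ltW t0) ?(ltW sigma0) ?sqrtr_ge0.
  - by move=> i; exact: goe_mat_sym gm w i.
  - exact: signal_sym.
  - exact: signal_psd.
  - by move=> a; rewrite sdE; exact: signal_lower.
  - exact: signal_perp.
  - move: hkappa; rewrite -sdE ler_pdivrMr ?mulr_gt0// => /le_trans; apply.
    by rewrite ler_wpM2r ?mulr_ge0 ?(ltW mu0) ?(ltW sd0)// le_max lexx.
  - exact: signal_rank.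
  - have -> : 2 * r%:R * (8 * t) * (4 * k1 + 1) = q * (r%:R * g) / 20.
      by rewrite tE qE; field.
    by rewrite ler_pdivrMr// mulVf.
have nuE : 4 * t * sigma * Num.sqrt n%:R = 196 * sigma * sd.
  by rewrite -gn tE; ring.
have nuL : 4 * t * sigma * Num.sqrt n%:R + `|lambda| <= (196 + L) * sigma * sd.
  rewrite nuE; lra.
have nu_small : 4 * t * sigma * Num.sqrt n%:R + `|lambda| <= mu * sd / 20.
  apply: (le_trans nuL); have : 20 * (196 + L) * sigma * sd <= mu * sd.
    by rewrite ler_wpM2r// ltW.
  lra.
have [unit bound] := debias_deterministic gd nu_small c0 cl.
split => //.
have sr0 : 0 < Num.sqrt (r%:R : R) by rewrite sqrtr_gt0.
rewrite sqrtrM ?ler0n// -sdE ler_pdivrMl ?mulr_gt0//.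
apply: (le_trans bound).
have s2r : Num.sqrt (2 * r)%:R <= 2 * Num.sqrt r%:R :> R.
  rewrite natrM sqrtrM// ler_wpM2r ?(ltW sr0)//.
  by rewrite -[leRHS]ger0_norm// -sqrtr_sqr ler_sqrt ?exprn_ge0//; lra.
apply: (@le_trans _ _ (80 * (2 * Num.sqrt r%:R) * (r%:R * (8 * t) * ((196 + L) * sigma * sd)))).
  apply: ler_pM.
  - by rewrite mulr_ge0 ?sqrtr_ge0.
  - by rewrite !mulr_ge0 ?(ltW t0) ?addr_ge0 ?mulr_ge0 ?sqrtr_ge0 ?(ltW sigma0) ?(ltW t0).
  - by rewrite ler_wpM2l.
  - by rewrite ler_wpM2l// mulr_ge0// mulr_ge0// ltW.
by rewrite tE -gE le_eqVlt; apply/orP; left; apply/eqP; ring.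
Qed.
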